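(* Let $X$ be a Dedekind complete (complex) Banach lattice, let $S$ be a $d$-isomorphism of $X$, let $A \in Z(X)$, and let $T = AS$. Let $Y$ be an $AIM$-subspace of $X$ such that $TY \subseteq Y$. Then $\sigma_{ap}(T,X) = \sigma_{ap}(T,Y)$.
   Context: All Banach lattices are over $\mathbb{C}$. $Z(X)$ is the center of $X$ (all linear operators $A$ on $X$ for which there is $c \geq 0$ with $|Ax| \leq c|x|$ for all $x \in X$). A $d$-isomorphism of $X$ is a linear, bounded, invertible operator $S$ on $X$ that preserves disjointness, i.e. $|x_1| \wedge |x_2| = 0$ implies $|Sx_1| \wedge |Sx_2| = 0$. For a Banach space $W$ invariant under a bounded linear operator $T$, $\sigma(T,W)$ is the spectrum of $T$ as an operator on $W$; $\sigma_r(T,W) = \{\lambda \in \sigma(T,W) : \exists c>0 \ \|\lambda x - Tx\| \geq c\|x\| \text{ for all } x \in W\}$; and $\sigma_{ap}(T,W) = \sigma(T,W) \setminus \sigma_r(T,W)$. A closed subspace $Y$ of $X$ is an $AIM$-subspace (approximating in modulus) if for any $x \in X$ and any $\varepsilon > 0$ there is $y \in Y$ such that $\||x| - |y|\| \leq \varepsilon$. *)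

(* Defs.v *)
From HB Require Import structures.
From mathcomp Require Import all_boot all_order all_algebra.
From mathcomp Require Import all_classical all_reals all_analysis.
From mathcomp Require Import complex.

Set Implicit Arguments.
Unset Strict Implicit.
Unset Printing Implicit Defensive.

Import Order.TTheory GRing.Theory Num.Theory numFieldNormedType.Exports.

Local Open Scope classical_set_scope.
Local Open Scope ring_scope.
Local Open Scope complex_scope.

(* Real Banach lattices.  The order is a raw field because HB rejects a common
   substructure of Order.Lattice and NormedModule (Num.RealDomain would have to
   inherit from it). *)
HB.mixin Record isBanachLattice (R : realType) E & CompleteNormedModule R E := {
  vle : rel E;
  vmeet : E -> E -> E;
  vjoin : E -> E -> E;
  vle_refl : reflexive vle;
  vle_anti : antisymmetric vle;
  vle_trans : transitive vle;
  vle_meet : forall x y z : E, vle x (vmeet y z) = vle x y && vle x z;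
  vjoin_le : forall x y z : E, vle (vjoin x y) z = vle x z && vle y z;
  vleD2r : forall z x y : E, vle x y -> vle (x + z) (y + z);
  vscale_ge0 : forall (a : R) (x : E), 0 <= a -> vle 0 x -> vle 0 (a *: x);
  vle_norm : forall x y : E,
    vle (vjoin x (- x)) (vjoin y (- y)) -> `|x| <= `|y|
}.

#[short(type="banachLatticeType")]
HB.structure Definition BanachLattice (R : realType) :=
  {E of CompleteNormedModule R E & isBanachLattice R E}.

(* Alias of E carrying its order as a latticeType. *)
Definition ordered (E : Type) : Type := E.

Section ordered_lattice.
Context (R : realType) (E : banachLatticeType R).

HB.instance Definition _ := Choice.copy (ordered E) E.
HB.instance Definition _ := @Order.Le_isPOrder.Build ring_display (ordered E)
  (@vle R E) (@vle_refl R E) (@vle_anti R E) (@vle_trans R E).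
HB.instance Definition _ :=
  @Order.POrder_MeetJoin_isLattice.Build ring_display (ordered E)
    (@vmeet R E) (@vjoin R E) (@vle_meet R E) (@vjoin_le R E).

End ordered_lattice.

HB.mixin Record isDedekindComplete (R : realType) E & BanachLattice R E := {
  dedekind_complete : forall D : set (ordered E),
    has_sup D -> supremums D !=set0
}.

#[short(type="dedekindBanachLatticeType")]
HB.structure Definition DedekindBanachLattice (R : realType) :=
  {E of BanachLattice R E & isDedekindComplete R E}.

(* The pair (x, y) stands for x + iy. *)
Definition complexification (E : Type) : Type := (E * E)%type.

Section complexification_lmodule.
Context (R : realType) (E : banachLatticeType R).
Local Notation X := (complexification E).

HB.instance Definition _ := GRing.Zmodule.copy X (E * E)%type.

Definition cscale (l : R[i]) (z : X) : X :=
  (complex.Re l *: z.1 - complex.Im l *: z.2,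
   complex.Re l *: z.2 + complex.Im l *: z.1).

Fact cscaleA a b z : cscale a (cscale b z) = cscale (a * b) z.
Proof.
case: a b z => [a a'] [b b'] [x y]; rewrite /cscale /=; congr pair.
  rewrite scalerBr scalerDr !scalerA scalerBl scalerDl !opprD.
  by rewrite [LHS](AC (2*2) (1*4*(2*3))).
rewrite scalerBr scalerDr !scalerA scalerBl scalerDl.
by rewrite [LHS](AC (2*2) (1*4*(2*3))).
Qed.

Fact cscale1 : left_id 1 cscale.
Proof. by case=> x y; rewrite /cscale /= !scale1r !scale0r subr0 addr0. Qed.

Fact cscaleDr : right_distributive cscale +%R.
Proof.
move=> [a b] [x y] [x' y']; rewrite /cscale /=; congr pair.
  by rewrite !scalerDr opprD addrACA.
by rewrite !scalerDr addrACA.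
Qed.

Fact cscaleDl z : {morph cscale^~ z : a b / a + b}.
Proof.
move: z => [x y] [a b] [c d]; rewrite /cscale /=; congr pair.
  by rewrite !scalerDl opprD addrACA.
by rewrite !scalerDl addrACA.
Qed.

HB.instance Definition _ := GRing.Zmodule_isLmodule.Build R[i] X
  cscaleA cscale1 cscaleDr cscaleDl.

(* |z| is the supremum of Re (u z) over the complex numbers u of modulus 1. *)
Definition modulus (z : X) : E :=
  supremum (0 : ordered E)
    [set (u *: z).1 | u in [set u : R[i] | `|u| = 1]].

End complexification_lmodule.

Section modulus_theory.
Context (R : realType) (E : dedekindBanachLatticeType R).
Local Notation X := (complexification E).
Implicit Types (x y z : E) (v w : X).

Lemma vleD x y z t : vle x y -> vle z t -> vle (x + z) (y + t).
Proof.
move=> xy zt; apply: (@vle_trans _ _ (y + z)); first exact: vleD2r.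
by rewrite ![y + _]addrC; exact: vleD2r.
Qed.

Lemma vsub_ge0 x y : vle 0 (y - x) = vle x y.
Proof.
by apply/idP/idP => [/(vleD2r x)|/(vleD2r (- x))]; rewrite ?subrK ?add0r ?subrr.
Qed.

Lemma vle_scale (a : R) x y : 0 <= a -> vle x y -> vle (a *: x) (a *: y).
Proof.
by move=> a0 xy; rewrite -vsub_ge0 -scalerBr vscale_ge0// vsub_ge0.
Qed.

Lemma vle_joinl x y : vle x (vjoin x y).
Proof. by have := vle_refl (vjoin x y); rewrite vjoin_le => /andP[]. Qed.

Lemma vle_joinr x y : vle y (vjoin x y).
Proof. by have := vle_refl (vjoin x y); rewrite vjoin_le => /andP[]. Qed.

Lemma vge0_double x : vle 0 (x + x) -> vle 0 x.
Proof.
move=> x0; have -> : x = (2^-1 : R) *: (x + x).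
  by rewrite -[x + x]mulr2n -(scaler_nat 2 x) scalerA mulVf ?scale1r ?pnatr_eq0.
by rewrite vscale_ge0 ?invr_ge0.
Qed.

Lemma vabs_ge0 x : vle 0 (vjoin x (- x)).
Proof. by apply: vge0_double; rewrite -{1}(subrr x) vleD ?vle_joinl ?vle_joinr. Qed.

Lemma vabs_id x : vle 0 x -> vjoin x (- x) = x.
Proof.
move=> x0; apply: vle_anti; rewrite vle_joinl vjoin_le vle_refl/= andbT.
apply: (@vle_trans _ _ 0) => //.
by rewrite -(subrr x) -[X in vle X _]add0r vleD2r.
Qed.

Lemma vle_norm_ge0 x y : vle 0 x -> vle x y -> `|x| <= `|y|.
Proof.
move=> x0 xy; apply: vle_norm; rewrite !vabs_id//; exact: vle_trans xy.
Qed.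

Lemma vscale_abs (a : R) x : `|a| <= 1 -> vle (a *: x) (vjoin x (- x)).
Proof.
move=> a1; apply: (@vle_trans _ _ (`|a| *: vjoin x (- x))); last first.
  rewrite -vsub_ge0 -{1}(scale1r (vjoin x _)) -scalerBl.
  by rewrite vscale_ge0 ?subr_ge0 ?vabs_ge0.
case: (ger0P a) => a0; first by rewrite vle_scale ?vle_joinl.
by rewrite -[a *: x]opprK -scaleNr -scalerN vle_scale ?vle_joinr ?oppr_ge0 ?ltW.
Qed.

Let rot w : set (ordered E) :=
  [set (u *: w).1 | u in [set u : R[i] | `|u| = 1]].

Lemma norm1_bounds (u : R[i]) : `|u| = 1 ->
  `|complex.Re u| <= 1 /\ `|complex.Im u| <= 1.
Proof.
case: u => a b; rewrite normc_def => /(congr1 (@complex.Re R))/= ab1.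
have {}ab1 : a ^+ 2 + b ^+ 2 = 1.
  by rewrite -[LHS]sqr_sqrtr ?ab1 ?expr1n// addr_ge0 ?sqr_ge0.
by split; rewrite -(@ler_pXn2r _ 2)// ?nnegrE// expr1n real_normK ?num_real//
  -ab1 ?lerDl ?lerDr sqr_ge0.
Qed.

Lemma modulusP w : supremums (rot w) (modulus w).
Proof.
have : supremums (rot w) !=set0.
  apply: dedekind_complete; split.
    by exists (1 *: w).1, 1 => //=; rewrite normr1.
  exists (vjoin w.1 (- w.1) + vjoin w.2 (- w.2)).
  move=> _ [u /norm1_bounds[u1 u2] <-].
  by apply: vleD; rewrite -?scaleNr; apply: vscale_abs; rewrite ?normrN.
case=> m mP; rewrite /modulus /supremum ifF; last first.
  apply/eqP => /(congr1 (fun A => A (1 *: w).1)) /= <-.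
  by exists 1 => //=; rewrite normr1.
by apply: xgetPex; exists m.
Qed.

Lemma modulus_ub w (u : R[i]) : `|u| = 1 -> vle (u *: w).1 (modulus w).
Proof. by move=> u1; have [+ _] := modulusP w; apply; exists u. Qed.

Lemma modulus_lub w x :
  (forall u : R[i], `|u| = 1 -> vle (u *: w).1 x) -> vle (modulus w) x.
Proof.
by move=> ubx; have [_] := modulusP w; apply => _ [u u1 <-]; exact: ubx.
Qed.

Lemma modulus_ge0 w : vle 0 (modulus w).
Proof.
apply: vge0_double.
have u1 := @modulus_ub w 1 (normr1 _).
have u2 := @modulus_ub w (-1) (normrN1 _).
by have := vleD u1 u2; rewrite scaleN1r scale1r/= subrr.
Qed.

Lemma ler_modulusD v w : vle (modulus (v + w)) (modulus v + modulus w).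
Proof.
by apply: modulus_lub => u u1; rewrite scalerDr vleD// modulus_ub.
Qed.

Lemma modulus_le w :
  vle (modulus w) (vjoin w.1 (- w.1) + vjoin w.2 (- w.2)).
Proof.
apply: modulus_lub => u /norm1_bounds[u1 u2].
by apply: vleD; rewrite -?scaleNr; apply: vscale_abs; rewrite ?normrN.
Qed.

Lemma modulus0 : modulus (0 : X) = 0.
Proof.
apply: vle_anti; rewrite modulus_ge0 andbT.
by apply: modulus_lub => u _; rewrite scaler0 vle_refl.
Qed.

Lemma scaler_real (a : R) w : (a%:C *: w).1 = a *: w.1.
Proof. by rewrite /= scale0r subr0. Qed.

Lemma normC_real (l : R[i]) : `|l| = (complex.Re `|l|)%:C.
Proof. by rewrite normc_def. Qed.

Lemma vle_modulusZ (l : R[i]) w :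
  l != 0 -> vle (modulus (l *: w)) (complex.Re `|l| *: modulus w).
Proof.
move=> l0; apply: modulus_lub => u u1; rewrite scalerA.
have l1 : `|l| != 0 by rewrite normr_eq0.
have -> : u * l = `|l| * (u * l / `|l|) by rewrite mulrCA divff ?mulr1.
rewrite -scalerA {1}normC_real scaler_real vle_scale//.
  by rewrite -lecR -normC_real normr_ge0.
by rewrite modulus_ub// normrM normfV normr_id normrM u1 mul1r divff.
Qed.

Lemma modulusZ (l : R[i]) w : modulus (l *: w) = complex.Re `|l| *: modulus w.
Proof.
have [->|l0] := eqVneq l 0; first by rewrite normr0 !scale0r modulus0.
have c0 : 0 < complex.Re `|l| by rewrite -ltcR -normC_real normr_gt0.
apply: vle_anti; rewrite vle_modulusZ//=.
have := @vle_modulusZ l^-1 (l *: w); rewrite invr_eq0 => /(_ l0).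
rewrite scalerA mulVf// scale1r => /(vle_scale (ltW c0)).
rewrite normfV scalerA [`|l| in X in _ * X]normC_real -fmorphV/=.
by rewrite divff ?gt_eqF// scale1r.
Qed.

Lemma modulus_eq0 w : modulus w = 0 -> w = 0.
Proof.
move=> w0; have ub u : `|u| = 1 -> vle (u *: w).1 0.
  by move=> u1; rewrite -w0 modulus_ub.
have e1 : w.1 = 0.
  apply: vle_anti; have := ub 1 (normr1 _); rewrite scale1r => ->.
  have := ub (-1) (normrN1 _); rewrite scaleN1r => /(vleD2r w.1).
  by rewrite addNr add0r.
have i1 : `|'i : R[i]| = 1 by rewrite normc_def/= expr0n expr1n add0r sqrtr1.
have e2 : w.2 = 0.
  apply: vle_anti; have := ub (- 'i) _; rewrite normrN => /(_ i1).
  rewrite /= oppr0 scale0r scaleN1r opprK add0r => ->.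
  have := ub 'i i1; rewrite /= scale0r scale1r add0r => /(vleD2r w.2).
  by rewrite addNr add0r.
by case: w e1 e2 {w0 ub} => /= ? ? -> ->.
Qed.

Definition cnorm w : R[i] := `|modulus w|%:C.

Fact cnormD v w : cnorm (v + w) <= cnorm v + cnorm w.
Proof.
rewrite /cnorm -rmorphD lecR.
apply: le_trans (ler_normD _ _).
by rewrite vle_norm_ge0 ?modulus_ge0 ?ler_modulusD.
Qed.

Fact cnormZ (l : R[i]) w : cnorm (l *: w) = `|l| * cnorm w.
Proof.
rewrite /cnorm modulusZ normrZ ger0_norm; last first.
  by rewrite -lecR -normC_real normr_ge0.
by rewrite [in RHS]normC_real -rmorphM.
Qed.

Fact cnorm_eq0 w : cnorm w = 0 -> w = 0.
Proof. by move=> /(congr1 (@complex.Re R))/= /normr0_eq0/modulus_eq0. Qed.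

HB.instance Definition _ := Lmodule_isNormed.Build R[i] X
  cnormD cnormZ cnorm_eq0.

Lemma vabs_norm x : `|vjoin x (- x)| = `|x|.
Proof.
by apply: le_anti; apply/andP; split; apply: vle_norm;
  rewrite (vabs_id (vabs_ge0 x)) vle_refl.
Qed.

Lemma cnorm_fst w : `|w.1|%:C <= `|w|.
Proof.
rewrite lecR; apply: vle_norm; rewrite (vabs_id (modulus_ge0 w)) vjoin_le.
rewrite -{1}(scale1r w) modulus_ub ?normr1//=.
by have := @modulus_ub w (-1) (normrN1 _); rewrite scaleN1r.
Qed.

Lemma cnorm_snd w : `|w.2|%:C <= `|w|.
Proof.
have i1 : `|'i : R[i]| = 1 by rewrite normc_def/= expr0n expr1n add0r sqrtr1.
have := cnorm_fst ('i *: w); rewrite [X in _ <= X]normrZ i1 mul1r.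
by rewrite /= scale0r scale1r add0r normrN.
Qed.

Lemma cnorm_le w : `|w| <= (`|w.1| + `|w.2|)%:C.
Proof.
rewrite lecR -[`|w.1|]vabs_norm -[`|w.2|]vabs_norm.
apply: le_trans (ler_normD _ _); rewrite vle_norm_ge0 ?modulus_ge0//.
by exact: modulus_le.
Qed.

Fact complexification_complete (F : set_system X) :
  ProperFilter F -> cauchy F -> cvg F.
Proof.
move=> FF /cauchyP Fc.
have cvgp (p : X -> E) : (forall v w, `|p v - p w|%:C <= `|v - w|) ->
    cvg (p @ F).
  move=> ple; apply: cauchy_cvg; apply/cauchyP => e e0.
  have [v Fv] := Fc e%:C (ltac:(by rewrite ltcR)).
  exists (p v); rewrite /= nbhs_filterE /fmap/=; apply: filterS Fv => w.
  rewrite -!ball_normE/= -ltcR; exact: le_lt_trans.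
have /cvg_ex[a Fa] := cvgp fst (fun v w => cnorm_fst (v - w)).
have /cvg_ex[b Fb] := cvgp snd (fun v w => cnorm_snd (v - w)).
apply/cvg_ex; exists (a, b); apply/cvgrPdist_le => e e0.
have [d d0 de] : exists2 d : R, 0 < d & e = (d + d)%:C.
  exists (complex.Re e / 2).
    by rewrite divr_gt0// -ltcR RRe_real ?gtr0_real.
  by rewrite -splitr RRe_real ?gtr0_real.
move/cvgrPdist_le : Fa => /(_ d d0) Fa; move/cvgrPdist_le : Fb => /(_ d d0) Fb.
near=> w; rewrite de; apply: le_trans (cnorm_le _) _; rewrite lecR lerD//.
  by near: w.
by near: w.
Unshelve. all: by end_near. Qed.

HB.instance Definition _ :=
  Uniform_isComplete.Build X complexification_complete.

End modulus_theory.

Section spectra.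
Context (K : numFieldType) (V : normedModType K).
Implicit Types (W : set V) (B T : V -> V).

Definition bounded_operator_on W B :=
  [/\ forall x, W x -> W (B x),
      forall (a : K) x y, W x -> W y -> B (a *: x + y) = a *: B x + B y &
      exists M : K, forall x, W x -> `|B x| <= M * `|x|].

Definition invertible_on W B := exists B' : V -> V,
  [/\ bounded_operator_on W B', {in W, cancel B B'} & {in W, cancel B' B}].

Definition spectrum T W : set K :=
  [set l | ~ invertible_on W (fun x => l *: x - T x)].

Definition spectrum_r T W : set K := [set l | spectrum T W l /\
  exists2 c : K, 0 < c & forall x, W x -> c * `|x| <= `|l *: x - T x|].

Definition spectrum_ap T W : set K := spectrum T W `\` spectrum_r T W.

End spectra.

Section lattice_operators.
Context (R : realType) (E : dedekindBanachLatticeType R).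
Local Notation X := (complexification E).

Definition in_center (A : {linear X -> X}) :=
  exists2 c : R, 0 <= c & forall x : X, vle (modulus (A x)) (c *: modulus x).

Definition d_isomorphism (S : {linear X -> X}) :=
  [/\ bounded_operator_on setT S, invertible_on setT S &
      forall x1 x2 : X, vmeet (modulus x1) (modulus x2) = 0 ->
        vmeet (modulus (S x1)) (modulus (S x2)) = 0].

Definition aim_subspace (Y : set X) :=
  [/\ submod_closed (mem Y), closed Y &
      forall (x : X) (e : R), 0 < e ->
        exists2 y, Y y & `|modulus x - modulus y| <= e].

End lattice_operators.

(* Main.v *)
Require Import Defs.
From HB Require Import structures.
From mathcomp Require Import all_boot all_order all_algebra.
From mathcomp Require Import all_classical all_reals all_analysis.
From mathcomp Require Import complex ring lra.

(** An operator with a bounded inverse is bounded below, so that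
    [spectrum_ap T W] is the set of the [l] for which [l - T] is not bounded
    below on [W]. The inclusion of the spectrum on [Y] in the spectrum on [X] is
    then clear, and the theorem says that a lower estimate
    [c |y| <= |l y - T y|] on [Y], with norms, extends to [X].

    The bridge between [Y] and [X] is that a bounded operator [f] preserving
    disjointness satisfies [|f x| <= |f z|] as soon as [|x| <= |z|]
    ([image_mono]). In particular [|f z|] depends on [|z|] only, and, [Y]
    approximating every modulus, a lower estimate of [h] by [f] passes from [Y]
    to [X] when both preserve disjointness, and to a band of [X] when they do so
    on this band ([aim_lower]). Applied to [f = 1] and [h = T] this settles
    [l = 0]. Monotonicity also shows that the inverse of [S] preserves
    disjointness ([disj_isoI]).

    Dividing [T] by [l], assume [l = 1]. The operator [1 - T] does not preserve
    disjointness, but on a band [B] disjoint from its images under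
    [S, ..., S ^ (n-1)], and under [S ^ n] too unless [S ^ n] is local on [B],
    every combination of [1, T, ..., T ^ n] does. Hence for
    [w = a_0 z + ... + a_(n-1) T ^ (n-1) z], with [z] in [B], the estimate
    [c |w| <= |w - T w|] holds. Two choices of weights are used. Where [S ^ n]
    acts locally and the smaller powers do not, constant weights give
    [w - T w = z - T ^ n z], and [z - T ^ n z] is a component of [x - T ^ n x]
    when [z] is one of [x] ([lower_periodic]). Where no small power of [S] is
    local, weights decreasing geometrically from the middle of a long tower make
    [w - T w] smaller than [w] up to the two ends of the tower
    ([lower_antiperiodic]). In both cases finitely many towers, in a number
    linear in their height, suffice to cover ([free_cover]), and splitting [X]
    into finitely many bands of these two kinds concludes ([lower_extends]). *)

Set Implicit Arguments.
Unset Strict Implicit.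
Unset Printing Implicit Defensive.

Import Order.TTheory GRing.Theory Num.Theory numFieldNormedType.Exports.
Local Open Scope classical_set_scope.
Local Open Scope ring_scope.

Local Notation "x <=v y" := (vle x y) (at level 70, no associativity).

(** * Order and lattice operations *)

Section VectorLattice.
Context {R : realType} {E : dedekindBanachLatticeType R}.
Implicit Types (x y z a b c : E) (k : R).

Lemma vtrans x y z : x <=v y -> y <=v z -> x <=v z.
Proof. exact: vle_trans. Qed.

Lemma vleDr z x y : (x + z <=v y + z) = (x <=v y).
Proof. by rewrite -vsub_ge0 opprD addrACA subrr addr0 vsub_ge0. Qed.

Lemma vleDl z x y : (z + x <=v z + y) = (x <=v y).
Proof. by rewrite ![z + _]addrC vleDr. Qed.

Lemma vle_subl x y z : (x - y <=v z) = (x <=v z + y).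
Proof. by rewrite -(vleDr y) subrK. Qed.

Lemma vle_subr x y z : (x <=v y - z) = (x + z <=v y).
Proof. by rewrite -(vleDr z) subrK. Qed.

Lemma vleN x y : (- x <=v - y) = (y <=v x).
Proof. by rewrite -vsub_ge0 opprK addrC vsub_ge0. Qed.

Lemma vle_addr x y : 0 <=v y -> x <=v x + y.
Proof. by move=> y0; rewrite -{1}(addr0 x) vleDl. Qed.

Lemma vle_addl x y : 0 <=v y -> x <=v y + x.
Proof. by rewrite addrC; exact: vle_addr. Qed.

Lemma vadd_ge0 x y : 0 <=v x -> 0 <=v y -> 0 <=v x + y.
Proof. by move=> x0 y0; have := vleD x0 y0; rewrite addr0. Qed.

Lemma vle_scalel k l x : k <= l -> 0 <=v x -> k *: x <=v l *: x.
Proof. by move=> kl x0; rewrite -vsub_ge0 -scalerBl vscale_ge0// subr_ge0. Qed.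

Lemma vle_scaleV k x y : 0 < k -> (k^-1 *: x <=v y) = (x <=v k *: y).
Proof.
move=> k0; apply/idP/idP => [/(vle_scale (ltW k0))|].
  by rewrite scalerA divff ?gt_eqF// scale1r.
have kV : 0 <= k^-1 by rewrite invr_ge0 ltW.
by move=> /(vle_scale kV); rewrite scalerA mulVf ?gt_eqF// scale1r.
Qed.

Lemma vmeet_lel x y : vmeet x y <=v x.
Proof. by have := vle_refl (vmeet x y); rewrite vle_meet => /andP[]. Qed.

Lemma vmeet_ler x y : vmeet x y <=v y.
Proof. by have := vle_refl (vmeet x y); rewrite vle_meet => /andP[]. Qed.

Lemma vmeet_glb x y z : z <=v x -> z <=v y -> z <=v vmeet x y.
Proof. by rewrite vle_meet => -> ->. Qed.

Lemma vmeet_ge0 x y : 0 <=v x -> 0 <=v y -> 0 <=v vmeet x y.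
Proof. exact: vmeet_glb. Qed.

Lemma vmeetC x y : vmeet x y = vmeet y x.
Proof. by apply: vle_anti; rewrite !vle_meet !vmeet_lel !vmeet_ler. Qed.

Lemma vmeet_mono x x' y y' :
  x <=v x' -> y <=v y' -> vmeet x y <=v vmeet x' y'.
Proof.
move=> xx yy; apply: vmeet_glb.
  exact: vtrans (vmeet_lel _ _) xx.
exact: vtrans (vmeet_ler _ _) yy.
Qed.

Lemma vmeetD_le a b c : 0 <=v a -> 0 <=v b -> 0 <=v c ->
  vmeet a (b + c) <=v vmeet a b + vmeet a c.
Proof.
move=> a0 b0 c0; set w := vmeet a (b + c).
have wa : w <=v a := vmeet_lel _ _.
have wbc : w <=v b + c := vmeet_ler _ _.
rewrite addrC -vle_subl; apply: vmeet_glb.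
  by rewrite vle_subl; apply: vtrans wa _; apply: vle_addr; exact: vmeet_ge0.
rewrite vle_subl addrC -vle_subl; apply: vmeet_glb; rewrite vle_subl //.
exact: vtrans wa (vle_addr _ c0).
Qed.

Lemma vle_cancel_disjoint a b c : 0 <=v a -> 0 <=v b -> 0 <=v c ->
  vmeet a c = 0 -> a <=v b + c -> a <=v b.
Proof.
move=> a0 b0 c0 ac abc.
have : a <=v vmeet a (b + c) by apply: vmeet_glb => //; exact: vle_refl.
move=> h; apply: (vtrans h).
apply: (vtrans (vmeetD_le a0 b0 c0)).
by rewrite ac addr0 vmeet_ler.
Qed.

(** The sum of two disjoint elements is their supremum. *)
Lemma vadd_disjoint_le a b z :
  vmeet a b = 0 -> a <=v z -> b <=v z -> a + b <=v z.
Proof.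
move=> ab az bz.
suff : a + b - z <=v vmeet a b by rewrite ab vle_subl add0r.
apply: vmeet_glb; rewrite vle_subl; first by rewrite vleDl.
by rewrite addrC vleDl.
Qed.

Lemma vmeet0_sub a b c k : 0 <= k -> 0 <=v a -> 0 <=v b -> 0 <=v c ->
  a <=v k *: b -> vmeet b c = 0 -> vmeet a c = 0.
Proof.
move=> k0 a0 b0 c0 ab bc; apply: vle_anti; rewrite vmeet_ge0// andbT.
have k1 : 0 < k + 1 by rewrite ltr_wpDl.
have k1' : 1 <= k + 1 by rewrite lerDr.
rewrite -(scaler0 _ (k + 1)) -vle_scaleV// -bc; apply: vmeet_glb.
  rewrite vle_scaleV//; apply: vtrans (vmeet_lel _ _) (vtrans ab _).
  by apply: vle_scalel => //; rewrite lerDl.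
rewrite vle_scaleV//; apply: vtrans (vmeet_ler _ _) _.
by rewrite -{1}(scale1r c) vle_scalel.
Qed.

Lemma vjoin_lub x y z : x <=v z -> y <=v z -> vjoin x y <=v z.
Proof. by rewrite vjoin_le => -> ->. Qed.

Lemma vpos_sub x : vjoin x 0 - vjoin (- x) 0 = x.
Proof.
suff -> : vjoin (- x) 0 = vjoin x 0 - x by rewrite opprB addrCA subrr addr0.
apply: vle_anti; apply/andP; split.
  apply: vjoin_lub; rewrite vle_subr ?add0r ?addNr; first exact: vle_joinr.
  exact: vle_joinl.
rewrite vle_subl; apply: vjoin_lub; rewrite -vle_subl ?subrr ?sub0r.
  exact: vle_joinr.
exact: vle_joinl.
Qed.

Lemma vpos_meet x : vmeet (vjoin x 0) (vjoin (- x) 0) = 0.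
Proof.
apply: vle_anti; rewrite vmeet_ge0 ?vle_joinr// andbT.
set m := vmeet _ _.
suff : vjoin x 0 <=v vjoin x 0 - m.
  by rewrite vle_subr -{2}(addr0 (vjoin x 0)) vleDl.
apply: vjoin_lub; rewrite vle_subr ?add0r ?vmeet_lel//.
by rewrite addrC -vle_subr -{2}(vpos_sub x) opprB addrCA subrr addr0 vmeet_ler.
Qed.

(** The positive cone is norm closed, whence this limit form of an
    inequality. *)
Lemma vle_lim x y :
  (forall e : R, 0 < e -> exists2 s : E, `|s| <= e & x <=v y + s) -> x <=v y.
Proof.
move=> lim; suff j0 : vjoin (x - y) 0 = 0.
  by rewrite -[y]add0r -vle_subl -j0 vle_joinl.
apply: normr0_eq0; apply/eqP; rewrite eq_le normr_ge0 andbT.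
apply/ler_addgt0Pl => e /lim[s se xys]; rewrite addr0.
apply: le_trans se; rewrite -(vabs_norm s); apply: vle_norm_ge0.
  exact: vle_joinr.
apply: vjoin_lub; last exact: vabs_ge0.
by rewrite vle_subl addrC; apply: vtrans xys _; rewrite vleDl vle_joinl.
Qed.

End VectorLattice.

(** * Modulus, norm and disjointness *)

Section Modulus.
Context {R : realType} {E : dedekindBanachLatticeType R}.
Local Notation X := (complexification E).
Implicit Types (a b c e : E) (x y z : X) (k : R).

Definition creal (a : E) : X := (a, 0).

(** The norm of the complexification takes its values in [R[i]]; this is the
    underlying real number. *)
Definition rnorm (x : X) : R := `|modulus x|.

Definition disj (x y : X) := vmeet (modulus x) (modulus y) = 0.

Lemma crealD a b : creal (a + b) = creal a + creal b.
Proof. by rewrite /creal; congr pair; rewrite /= addr0. Qed.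

Lemma crealB a b : creal (a - b) = creal a - creal b.
Proof. by rewrite /creal; congr pair; rewrite /= subr0. Qed.

Lemma crealN a : creal (- a) = - creal a.
Proof. by rewrite /creal; congr pair; rewrite /= oppr0. Qed.

Lemma crealZ k a : creal (k *: a) = k%:C%C *: creal a.
Proof.
by rewrite /creal; congr pair; rewrite /= ?scale0r ?scaler0 ?subr0 ?addr0.
Qed.

Lemma creal_inj : injective creal.
Proof. by move=> a b []. Qed.

Lemma creal_decomp x : x = creal x.1 + 'i%C *: creal x.2.
Proof.
by apply: injective_projections; rewrite /= ?scale0r ?scaler0 ?scale1r
  ?subr0 ?addr0 ?add0r.
Qed.

Lemma norm_i : `|'i%C : R[i]%C| = 1.
Proof. by rewrite normc_def/= expr0n expr1n add0r sqrtr1. Qed.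

Lemma norm_real k : complex.Re `|k%:C%C : R[i]%C| = `|k|.
Proof. by rewrite normc_def/= expr0n addr0 sqrtr_sqr. Qed.

Lemma Renorm_ge0 (u : R[i]%C) : 0 <= complex.Re `|u|.
Proof. by rewrite -lecR -normC_real normr_ge0. Qed.

Lemma modulusZr k x : modulus (k%:C%C *: x) = `|k| *: modulus x.
Proof. by rewrite modulusZ norm_real. Qed.

Lemma modulusZi x : modulus ('i%C *: x) = modulus x.
Proof. by rewrite modulusZ norm_i scale1r. Qed.

Lemma modulusN x : modulus (- x) = modulus x.
Proof. by rewrite -scaleN1r modulusZ normrN normr1 scale1r. Qed.

Lemma modulus_fst x : vjoin x.1 (- x.1) <=v modulus x.
Proof.
apply: vjoin_lub.
  by have := @modulus_ub _ _ x 1 (normr1 _); rewrite scale1r.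
by have := @modulus_ub _ _ x (-1) (normrN1 _); rewrite scaleN1r.
Qed.

Lemma modulus_snd x : vjoin x.2 (- x.2) <=v modulus x.
Proof.
rewrite -(modulusZi x); have := modulus_fst ('i%C *: x).
rewrite /= scale0r scale1r add0r opprK => h; apply: vtrans h.
by apply: vjoin_lub; rewrite ?vle_joinl ?vle_joinr.
Qed.

Lemma modulus_creal a : modulus (creal a) = vjoin a (- a).
Proof.
apply: vle_anti; rewrite (modulus_fst (creal a)) andbT.
apply: modulus_lub => u /norm1_bounds[u1 _].
by rewrite /= scaler0 subr0; exact: vscale_abs.
Qed.

Lemma modulus_pos a : 0 <=v a -> modulus (creal a) = a.
Proof. by move=> a0; rewrite modulus_creal vabs_id. Qed.

Lemma modulus_modulus x : modulus (creal (modulus x)) = modulus x.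
Proof. exact: modulus_pos (modulus_ge0 x). Qed.

Lemma modulus_le_add x y : modulus x <=v modulus (x + y) + modulus y.
Proof.
by rewrite -{1}(addrK y x) -(modulusN y); exact: ler_modulusD.
Qed.

Lemma rnorm_ge0 x : 0 <= rnorm x.
Proof. exact: normr_ge0. Qed.

Lemma normE x : `|x| = (rnorm x)%:C%C.
Proof. by []. Qed.

Lemma rnorm_mono x y : modulus x <=v modulus y -> rnorm x <= rnorm y.
Proof. by apply: vle_norm_ge0; exact: modulus_ge0. Qed.

Lemma rnormD x y : rnorm (x + y) <= rnorm x + rnorm y.
Proof. by have := ler_normD x y; rewrite !normE -rmorphD lecR. Qed.

Lemma rnormZ (u : R[i]%C) x : rnorm (u *: x) = complex.Re `|u| * rnorm x.
Proof. by rewrite /rnorm modulusZ normrZ ger0_norm ?Renorm_ge0. Qed.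

Lemma rnormN x : rnorm (- x) = rnorm x.
Proof. by rewrite /rnorm modulusN. Qed.

Lemma rnormB x y : rnorm (x - y) <= rnorm x + rnorm y.
Proof. by rewrite -(rnormN y) rnormD. Qed.

Lemma rnorm_le_sub x y : rnorm x <= rnorm y + rnorm (x - y).
Proof. by have := rnormD y (x - y); rewrite addrCA subrr addr0. Qed.

Lemma rnorm0 : rnorm 0 = 0.
Proof. by rewrite /rnorm modulus0 normr0. Qed.

Lemma rnorm_creal a : rnorm (creal a) = `|a|.
Proof. by rewrite /rnorm modulus_creal vabs_norm. Qed.

Lemma disjC x y : disj x y -> disj y x.
Proof. by rewrite /disj vmeetC. Qed.

Lemma disj_sub k x x' y : 0 <= k ->
  modulus x' <=v k *: modulus x -> disj x y -> disj x' y.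
Proof. by move=> k0; apply: vmeet0_sub k0 _ _ _; exact: modulus_ge0. Qed.

Lemma disj_le x x' y : modulus x' <=v modulus x -> disj x y -> disj x' y.
Proof. by move=> h; apply: (@disj_sub 1) => //; rewrite scale1r. Qed.

Lemma disjD x y z : disj x z -> disj y z -> disj (x + y) z.
Proof.
rewrite /disj => xz yz; apply: vle_anti; rewrite vmeet_ge0 ?modulus_ge0//.
rewrite andbT; apply: vtrans (vmeet_mono (ler_modulusD x y) (vle_refl _)) _.
rewrite vmeetC; apply: vtrans (vmeetD_le _ _ _) _; rewrite ?modulus_ge0//.
by rewrite vmeetC xz vmeetC yz addr0 vle_refl.
Qed.

Lemma disjZ (u : R[i]%C) x y : disj x y -> disj (u *: x) y.
Proof.
by apply: (disj_sub (Renorm_ge0 u)); rewrite modulusZ vle_refl.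
Qed.

Lemma disj0 x : disj 0 x.
Proof.
rewrite /disj modulus0; apply: vle_anti.
by rewrite vmeet_lel vmeet_ge0 ?vle_refl ?modulus_ge0.
Qed.

Lemma disj_self x : disj x x -> x = 0.
Proof.
rewrite /disj => xx; apply: modulus_eq0; apply: vle_anti.
by rewrite modulus_ge0 -{1}xx vmeet_glb ?vle_refl.
Qed.

Lemma disj_sum n (F : 'I_n -> X) y :
  (forall i, disj (F i) y) -> disj (\sum_i F i) y.
Proof.
by move=> Fy; elim/big_ind: _ => // [|x z]; [exact: disj0|exact: disjD].
Qed.

Lemma disj_le_cancel x y z : disj x z ->
  modulus x <=v modulus y + modulus z -> modulus x <=v modulus y.
Proof. by apply: vle_cancel_disjoint; exact: modulus_ge0. Qed.

(** Each summand lies below the modulus of the sum, by cancelling the other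
    one. *)
Lemma modulusD x y : disj x y -> modulus (x + y) = modulus x + modulus y.
Proof.
move=> xy; apply: vle_anti; rewrite ler_modulusD/=.
apply: vadd_disjoint_le => //.
  by apply: disj_le_cancel xy _; exact: modulus_le_add.
apply: disj_le_cancel (disjC xy) _; rewrite (addrC x y).
exact: modulus_le_add.
Qed.

Lemma modulus_leDl x y : disj x y -> modulus x <=v modulus (x + y).
Proof. by move=> /modulusD ->; rewrite vle_addr ?modulus_ge0. Qed.

Lemma rnorm_leDl x y : disj x y -> rnorm x <= rnorm (x + y).
Proof. by move=> /modulus_leDl; exact: rnorm_mono. Qed.

Lemma rnorm_leDr x y : disj x y -> rnorm y <= rnorm (x + y).
Proof. by move=> /disjC; rewrite addrC; exact: rnorm_leDl. Qed.

End Modulus.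

(** * Band projections *)

Section Bands.
Context {R : realType} {E : dedekindBanachLatticeType R}.
Local Notation X := (complexification E).
Implicit Types (a b c e : E) (x y z : X) (k : R) (D : set X).

Definition dcompl D : set X := [set x | forall d, D d -> disj x d].

Lemma dcomplD D x y : dcompl D x -> dcompl D y -> dcompl D (x + y).
Proof. by move=> xD yD d dD; apply: disjD; [exact: xD|exact: yD]. Qed.

Lemma dcomplZ D u x : dcompl D x -> dcompl D (u *: x).
Proof. by move=> xD d dD; apply: disjZ; exact: xD. Qed.

Lemma dcomplN D x : dcompl D x -> dcompl D (- x).
Proof. by rewrite -scaleN1r; exact: dcomplZ. Qed.

Lemma dcomplB D x y : dcompl D x -> dcompl D y -> dcompl D (x - y).
Proof. by move=> xD yD; apply: dcomplD => //; exact: dcomplN. Qed.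

Lemma dcompl0 D : dcompl D 0.
Proof. by move=> d _; exact: disj0. Qed.

Lemma dcompl_le D x y : modulus x <=v modulus y -> dcompl D y -> dcompl D x.
Proof. by move=> xy yD d dD; apply: disj_le xy _; exact: yD. Qed.

Lemma dcompl_dcompl D x : D x -> dcompl (dcompl D) x.
Proof. by move=> Dx y yD; apply: disjC; exact: yD. Qed.

Lemma dcompl_dcI D x : dcompl D x -> dcompl (dcompl D) x -> x = 0.
Proof. by move=> xD xDD; apply: disj_self; exact: xDD. Qed.

(** Riesz decomposition for a positive element: its part in the band
    generated by [D] is the supremum of the elements of that band below it,
    and the supremum stays in the band because disjointness from a given
    element passes to suprema. *)
Lemma riesz_pos D a : 0 <=v a ->
  exists b, [/\ 0 <=v b, b <=v a, dcompl (dcompl D) (creal b) &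
    dcompl D (creal (a - b))].
Proof.
move=> a0.
pose A : set (ordered E) :=
  [set y | [/\ 0 <=v y, y <=v a & dcompl (dcompl D) (creal y)]].
have [|s [sub slub]] := @dedekind_complete _ E A.
  split; first by exists 0; split => //; [exact: vle_refl|exact: dcompl0].
  by exists a => y [].
have A0 : A 0 by split => //; [exact: vle_refl|exact: dcompl0].
have s0 : 0 <=v s := sub _ A0.
have sa : s <=v a by apply: slub => y [].
have sD : dcompl (dcompl D) (creal s).
  move=> g gD; rewrite /disj modulus_pos//.
  set m := vmeet s (modulus g).
  have m0 : 0 <=v m by rewrite vmeet_ge0 ?modulus_ge0.
  apply: vle_anti; rewrite m0 andbT.
  suff : s <=v s - m by rewrite vle_subr -{2}(addr0 s) vleDl.
  apply: slub => y Ay; change (y <=v s - m); rewrite vle_subr.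
  apply: vadd_disjoint_le; [|exact: sub|exact: vmeet_lel].
  case: Ay => y0 _ /(_ g gD); rewrite /disj modulus_pos// => yg.
  apply: vle_anti; rewrite vmeet_ge0// andbT -yg.
  by apply: vmeet_mono; [exact: vle_refl|exact: vmeet_ler].
exists s; split => // d dD.
have q0 : 0 <=v a - s by rewrite vsub_ge0.
rewrite /disj modulus_pos//; set w := vmeet _ _.
have w0 : 0 <=v w by rewrite vmeet_ge0 ?modulus_ge0.
apply: vle_anti; rewrite w0 andbT -(vleDl s) addr0; apply: sub.
split; first exact: vadd_ge0.
  by rewrite addrC -vle_subr vmeet_lel.
rewrite crealD; apply: dcomplD => //; apply: (dcompl_le _ (dcompl_dcompl dD)).
by rewrite modulus_pos// vmeet_ler.
Qed.

Lemma riesz D x : exists p, dcompl (dcompl D) p /\ dcompl D (x - p).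
Proof.
have rr a : exists p, dcompl (dcompl D) p /\ dcompl D (creal a - p).
  have [b [_ _ bD abD]] := @riesz_pos D _ (vle_joinr a 0).
  have [c [_ _ cD acD]] := @riesz_pos D _ (vle_joinr (- a) 0).
  exists (creal b - creal c); split; first exact: dcomplB.
  have -> : creal a - (creal b - creal c) =
      creal (vjoin a 0 - b) - creal (vjoin (- a) 0 - c).
    rewrite -{1}(vpos_sub a) !crealB !opprB.
    by rewrite [LHS](AC (2*2) ((1*4)*(3*2))).
  exact: dcomplB.
have [p [pD xpD]] := rr x.1; have [q [qD xqD]] := rr x.2.
exists (p + 'i%C *: q); split; first by apply: dcomplD => //; exact: dcomplZ.
rewrite {1}(creal_decomp x) opprD addrACA -scalerBr.
by apply: dcomplD => //; exact: dcomplZ.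
Qed.

Definition proj D x : X := sval (cid (riesz D x)).

Lemma proj_in D x : dcompl (dcompl D) (proj D x).
Proof. by rewrite /proj; case: cid => p []. Qed.

Lemma proj_out D x : dcompl D (x - proj D x).
Proof. by rewrite /proj; case: cid => p []. Qed.

Arguments proj_in D x : clear implicits.
Arguments proj_out D x : clear implicits.

Lemma proj_uniq D x p : dcompl (dcompl D) p -> dcompl D (x - p) -> proj D x = p.
Proof.
move=> pD xpD; apply/eqP; rewrite -subr_eq0; apply/eqP.
apply: (@dcompl_dcI D); last by apply: dcomplB => //; exact: proj_in.
have -> : proj D x - p = (x - p) - (x - proj D x).
  by rewrite opprB [RHS]addrC subrKA.
by apply: dcomplB => //; exact: proj_out.
Qed.

Lemma proj_linear D : linear (proj D).
Proof.
move=> u x y; apply: proj_uniq.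
  by apply: dcomplD; [apply: dcomplZ|]; exact: proj_in.
rewrite opprD addrACA -scalerBr.
by apply: dcomplD; [apply: dcomplZ|]; exact: proj_out.
Qed.

HB.instance Definition _ D :=
  GRing.isLinear.Build R[i]%C X X *:%R (proj D) (@proj_linear D).

Lemma proj_disj D x : disj (proj D x) (x - proj D x).
Proof. by apply: proj_in; exact: proj_out. Qed.

Lemma modulus_proj D x :
  modulus x = modulus (proj D x) + modulus (x - proj D x).
Proof. by rewrite -(modulusD (proj_disj D x)) [proj D x + _]addrC subrK. Qed.

Lemma modulus_subproj D x :
  modulus (x - proj D x) = modulus x - modulus (proj D x).
Proof. by rewrite (modulus_proj D x) addrAC subrr add0r. Qed.

Lemma proj_le D x : modulus (proj D x) <=v modulus x.
Proof. by rewrite (modulus_proj D x) vle_addr ?modulus_ge0. Qed.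

Lemma subproj_le D x : modulus (x - proj D x) <=v modulus x.
Proof. by rewrite (modulus_proj D x) vle_addl ?modulus_ge0. Qed.

Lemma proj_fst D x : proj D (creal x.1) = creal (proj D x).1.
Proof.
apply: proj_uniq.
  by apply: (dcompl_le _ (proj_in D x)); rewrite modulus_creal modulus_fst.
rewrite -crealB; apply: (dcompl_le _ (proj_out D x)).
by rewrite modulus_creal; exact: modulus_fst (x - proj D x).
Qed.

Lemma proj_modulus D x :
  proj D (creal (modulus x)) = creal (modulus (proj D x)).
Proof.
apply: proj_uniq.
  by apply: (dcompl_le _ (proj_in D x)); rewrite modulus_modulus vle_refl.
rewrite -crealB -modulus_subproj; apply: (dcompl_le _ (proj_out D x)).
by rewrite modulus_modulus vle_refl.
Qed.

Lemma proj_ge0 D a : 0 <=v a -> 0 <=v (proj D (creal a)).1 /\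
  (proj D (creal a)).1 <=v a.
Proof.
move=> a0; have [b [b0 ba bD abD]] := @riesz_pos D a a0.
by rewrite (@proj_uniq D _ (creal b))// -crealB.
Qed.

Lemma proj_creal D a : proj D (creal a) = creal (proj D (creal a)).1.
Proof. by rewrite -(proj_fst D (creal a)). Qed.

(** The projection onto the band of the positive part of [a] separates the
    region where [a] is positive from the one where it is negative. *)
Lemma proj_pos a : proj [set creal (vjoin a 0)] (creal a) = creal (vjoin a 0).
Proof.
apply: proj_uniq; first exact: dcompl_dcompl.
move=> _ ->; rewrite -crealB.
have -> : a - vjoin a 0 = - vjoin (- a) 0.
  by rewrite -{1}(vpos_sub a) addrAC subrr add0r.
rewrite crealN /disj modulusN !modulus_pos ?vle_joinr// vmeetC.
exact: vpos_meet.
Qed.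

End Bands.

Arguments proj_in {R E} D x.
Arguments proj_out {R E} D x.

(** * Cutting an element into sectors *)

Section Sectors.
Context {R : realType} {E : dedekindBanachLatticeType R}.
Local Notation X := (complexification E).
Implicit Types (a b c e : E) (x y z : X) (k l m s t : R) (D : set X).

(** Band projections commute with such forms in [Re z], [Im z] and [|z|], whose
    signs express pointwise conditions on [z], such as a sector containing its
    values. *)
Definition rform k l m z : E := k *: z.1 + l *: z.2 + m *: modulus z.

Lemma proj_snd D x : proj D (creal x.2) = creal (proj D x).2.
Proof.
have := proj_fst D (- 'i%C *: x).
by rewrite [in RHS]linearZ/= !oppr0 !scale0r !sub0r !scaleN1r !opprK.
Qed.

Lemma proj_form D k l m z :
  proj D (creal (rform k l m z)) =
  creal (rform k l m (proj D z)).
Proof.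
by rewrite /rform !crealD !crealZ !linearD !linearZ/= proj_fst proj_snd
  proj_modulus.
Qed.

Lemma subproj_form D k l m z :
  rform k l m (z - proj D z) =
  rform k l m z - rform k l m (proj D z).
Proof.
rewrite /rform modulus_subproj/= !scalerBr !opprD.
by rewrite [LHS](AC ((2*2)*2) ((1*3*5)*((2*4)*6))).
Qed.

Lemma rform_proj D k l m z : 0 <=v rform k l m z ->
  0 <=v rform k l m (proj D z) /\ 0 <=v rform k l m (z - proj D z).
Proof.
by move=> /(proj_ge0 D); rewrite proj_form/= subproj_form vsub_ge0.
Qed.

(** The band is that of the positive part of the form at [z]. *)
Lemma rform_split k l m z : exists D,
  0 <=v rform k l m (proj D z) /\
  0 <=v rform (- k) (- l) (- m) (z - proj D z).
Proof.
pose w := rform k l m z; exists [set creal (vjoin w 0)].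
have := proj_pos w; rewrite {2}/w proj_form => /creal_inj wE.
have -> y : rform (- k) (- l) (- m) y = - rform k l m y.
  by rewrite /rform !scaleNr -!opprD.
rewrite subproj_form wE -/w opprB; split; first exact: vle_joinr.
by rewrite vsub_ge0 vle_joinl.
Qed.

(** [z] lies over the rectangle with corner [k + i l] and sides [s], [t],
    relative to [|z|]. *)
Definition cell k l s t z := [/\ 0 <=v rform 1 0 (- k) z,
  0 <=v rform (-1) 0 (k + s) z, 0 <=v rform 0 1 (- l) z &
  0 <=v rform 0 (-1) (l + t) z].

Lemma cell_halve1 k l s t z : cell k l (s + s) t z ->
  exists D, cell (k + s) l s t (proj D z) /\ cell k l s t (z - proj D z).
Proof.
move=> [c1 c2 c3 c4]; have [D [d1 d2]] := rform_split 1 0 (- (k + s)) z.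
exists D; move: d2; rewrite oppr0 opprK => d2.
have [? ?] := rform_proj D c1; have [? ?] := rform_proj D c2.
have [? ?] := rform_proj D c3; have [? ?] := rform_proj D c4.
by split; split; rewrite // -addrA.
Qed.

Lemma cell_halve2 k l s t z : cell k l s (t + t) z ->
  exists D, cell k (l + t) s t (proj D z) /\ cell k l s t (z - proj D z).
Proof.
move=> [c1 c2 c3 c4]; have [D [d1 d2]] := rform_split 0 1 (- (l + t)) z.
exists D; move: d2; rewrite oppr0 opprK => d2.
have [? ?] := rform_proj D c1; have [? ?] := rform_proj D c2.
have [? ?] := rform_proj D c3; have [? ?] := rform_proj D c4.
by split; split; rewrite // -addrA.
Qed.

Lemma cell_init z : cell (-1) (-1) 2 2 z.
Proof.
have e1 : - 1 + 2 = 1 :> R by rewrite -[2]/(1 + 1) addKr.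
have f1 := modulus_fst z; have f2 := modulus_snd z.
move: f1 f2; rewrite !vjoin_le => /andP[f1 f2] /andP[f3 f4].
split; rewrite /rform ?e1 ?opprK !(scale0r, scale1r, scaleN1r, add0r, addr0).
- by rewrite addrC -(opprK z.1) vsub_ge0.
- by rewrite addrC vsub_ge0.
- by rewrite addrC -(opprK z.2) vsub_ge0.
- by rewrite addrC vsub_ge0.
Qed.

Lemma cell_near k l s z : cell k l s s z ->
  modulus (z - (k +i* l)%C *: creal (modulus z)) <=v (s + s) *: modulus z.
Proof.
case; rewrite /rform !(scale0r, scale1r, scaleN1r, add0r, addr0).
rewrite ![- _ + _]addrC !vsub_ge0 !scalerDl !scaleNr !vsub_ge0 => c1 c2 c3 c4.
have h (u v w : E) : u <=v v -> v <=v u + w -> vjoin (v - u) (- (v - u)) <=v w.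
  move=> uv vuw; have uvw : v - u <=v w by rewrite vle_subl addrC.
  apply: vjoin_lub => //; rewrite opprB; apply: vtrans uvw.
  apply: (@vtrans _ _ _ 0); first by rewrite -oppr0 -opprB vleN vsub_ge0.
  by rewrite vsub_ge0.
apply: vtrans (modulus_le _) _ => /=; rewrite !scaler0 subr0 add0r.
by apply: vleD; apply: h.
Qed.

End Sectors.

(** * Disjointness preserving operators *)

Lemma geometric_small {R : realType} (q C e : R) :
  0 <= q -> q < 1 -> 0 < e -> exists n, q ^+ n * C <= e.
Proof.
move=> q0 q1 e0.
have : (fun n => q ^+ n * C) @ \oo --> 0 * C.
  by apply: cvgMl; apply: cvg_expr; rewrite ger0_norm.
rewrite mul0r => /cvgrPdist_le/(_ e e0)[n _ nP]; exists n.
have := nP n (leqnn n); rewrite /= sub0r normrN.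
by apply: le_trans; exact: ler_norm.
Qed.

Section DisjointnessPreserving.
Context {R : realType} {E : dedekindBanachLatticeType R}.
Local Notation X := (complexification E).
Implicit Types (a b c e : E) (x y z : X) (k l m s t : R) (D B : set X).

Definition rnorm_bounded (f : X -> X) :=
  exists2 K : R, 0 <= K & forall x, rnorm (f x) <= K * rnorm x.

Definition disj_preserving B (f : X -> X) :=
  forall x y, B x -> B y -> disj x y -> disj (f x) (f y).

Definition solid B := forall x y, modulus x <=v modulus y -> B y -> B x.

Lemma dcompl_solid D : solid (dcompl D).
Proof. by move=> x y; exact: dcompl_le. Qed.

Section Monotone.
Variables (f : {linear X -> X}) (B : set X).
Hypotheses (fb : rnorm_bounded f) (Bs : solid B) (fd : disj_preserving B f).

Lemma solid_proj D z : B z -> B (proj D z).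
Proof. by apply: Bs; exact: proj_le. Qed.

Lemma solid_subproj D z : B z -> B (z - proj D z).
Proof. by apply: Bs; exact: subproj_le. Qed.

Lemma modulus_image D z : B z ->
  modulus (f z) = modulus (f (proj D z)) + modulus (f (z - proj D z)).
Proof.
move=> Bz; have {1}-> : z = proj D z + (z - proj D z) by rewrite addrC subrK.
rewrite linearD modulusD//.
by apply: fd; [exact: solid_proj|exact: solid_subproj|exact: proj_disj].
Qed.

(** One binary digit of [a] relative to [e]: where [2 a >= e] subtract [e / 2],
    and double the rest. *)
Lemma dyadic_step e a : B (creal e) -> 0 <=v a -> a <=v e ->
  exists b, [/\ 0 <=v b, b <=v e & modulus (f (creal a)) <=v
     2^-1 *: modulus (f (creal e)) + 2^-1 *: modulus (f (creal b))].
Proof.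
move=> Be a0 ae; have e0 := vtrans a0 ae.
pose w := 2 *: a - e; pose D := [set creal (vjoin w 0)].
pose p := (proj D (creal e)).1; pose r := (proj D (creal a)).1.
have pE : proj D (creal e) = creal p := proj_creal D e.
have rE : proj D (creal a) = creal r := proj_creal D a.
have [r0 ra] : 0 <=v r /\ r <=v a := proj_ge0 D a0.
have wE : vjoin w 0 = 2 *: r - p.
  apply: creal_inj; rewrite -proj_pos /w -/w -/D.
  by rewrite /w !crealB !crealZ linearB linearZ/= pE rE.
have rp : 0 <=v p - r.
  have : 0 <=v e - a by rewrite vsub_ge0.
  by move=> /(proj_ge0 D)[+ _]; rewrite crealB linearB/= pE rE.
exists (2 *: a - p); split.
- have -> : 2 *: a - p = vjoin w 0 + 2 *: (a - r).
    by rewrite wE scalerBr [RHS]addrC subrKA.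
  apply: vadd_ge0; first exact: vle_joinr.
  by rewrite vscale_ge0// vsub_ge0.
- rewrite -vsub_ge0.
  have -> : e - (2 *: a - p) = vjoin w 0 - w + 2 *: (p - r).
    rewrite wE addrAC scalerBr [2 *: r - p + _]addrC subrKA.
    have -> : 2 *: p - p = p by rewrite scaler_nat mulr2n addrK.
    by rewrite /w !opprB addrCA.
  apply: vadd_ge0; first by rewrite vsub_ge0 vle_joinl.
  by rewrite vscale_ge0.
have aE : creal a = (2^-1)%:C%C *: (creal p + creal (2 *: a - p)).
  by rewrite -crealD addrC subrK -crealZ scalerA mulVf ?scale1r// pnatr_eq0.
rewrite {1}aE linearZ modulusZr ger0_norm ?invr_ge0// -scalerDr.
apply: vle_scale; first by rewrite invr_ge0.
rewrite linearD; apply: vtrans (ler_modulusD _ _) _; rewrite vleDr.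
by rewrite (modulus_image D Be) pE vle_addr ?modulus_ge0.
Qed.


Lemma dyadic_steps n e a : B (creal e) -> 0 <=v a -> a <=v e ->
  exists b, [/\ 0 <=v b, b <=v e & modulus (f (creal a)) <=v
    (1 - 2^-1 ^+ n) *: modulus (f (creal e)) +
    2^-1 ^+ n *: modulus (f (creal b))].
Proof.
move=> Be; elim: n a => [|n IH] a a0 ae.
  by exists a; split; rewrite // expr0 subrr scale0r scale1r add0r vle_refl.
have [b [b0 be ab]] := IH a a0 ae; have [c [c0 ce bc]] := dyadic_step Be b0 be.
exists c; split => //; apply: vtrans ab _.
have h0 : 0 <= (2^-1 : R) ^+ n by rewrite exprn_ge0// invr_ge0.
have -> : 1 - (2^-1 : R) ^+ n.+1 = 1 - 2^-1 ^+ n + 2^-1 ^+ n * 2^-1.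
  by rewrite exprSr; set h := _ ^+ n; lra.
rewrite [(1 - _ + _) *: _]scalerDl exprSr -!scalerA -addrA vleDl -scalerDr.
exact: vle_scale.
Qed.

(** Positive elements first: iterating [dyadic_step] writes [a] as a sum
    of components of [e] weighted by powers of two, each of which has an image
    dominated by that of [e]; norm boundedness disposes of the remainder. *)
Lemma image_mono_pos e a : B (creal e) -> 0 <=v a -> a <=v e ->
  modulus (f (creal a)) <=v modulus (f (creal e)).
Proof.
move=> Be a0 ae; apply: vle_lim => d d0; have [K K0 fK] := fb.
have [n nd] : exists n, 2^-1 ^+ n * (K * `|e|) <= d.
  by apply: geometric_small; rewrite ?invr_ge0 ?invf_lt1// ltr1n.
have [b [b0 be ab]] := dyadic_steps n Be a0 ae.
have h0 : 0 <= (2^-1 : R) ^+ n by rewrite exprn_ge0// invr_ge0.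
exists (2^-1 ^+ n *: modulus (f (creal b))).
  rewrite normrZ ger0_norm//; apply: le_trans nd; rewrite ler_wpM2l//.
  apply: le_trans (fK _) _; rewrite ler_wpM2l// rnorm_creal.
  exact: vle_norm_ge0.
apply: vtrans ab _; rewrite vleDr -{2}(scale1r (modulus (f (creal e)))).
by apply: vle_scalel; rewrite ?modulus_ge0// lerBlDr lerDl.
Qed.

Lemma image_mono_real e a : B (creal e) -> vjoin a (- a) <=v e ->
  modulus (f (creal a)) <=v modulus (f (creal e)).
Proof.
move=> Be ae; have a1 := vle_joinr a 0; have a2 := vle_joinr (- a) 0.
have e0 : 0 <=v e := vtrans (vabs_ge0 a) ae.
move: ae; rewrite vjoin_le => /andP[ae ae'].
have ae1 : vjoin a 0 <=v e by apply: vjoin_lub.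
have ae2 : vjoin (- a) 0 <=v e by apply: vjoin_lub.
have da : disj (creal (vjoin a 0)) (creal (vjoin (- a) 0)).
  by rewrite /disj !modulus_pos// vpos_meet.
have [B1 B2] : B (creal (vjoin a 0)) /\ B (creal (vjoin (- a) 0)).
  by split; apply: Bs Be; rewrite !modulus_pos.
have fda := fd B1 B2 da.
rewrite -(vpos_sub a) crealB linearB modulusD; last first.
  by apply: disjC; rewrite -scaleN1r; apply: disjZ; exact: disjC.
rewrite modulusN -modulusD// -linearD -crealD.
apply: image_mono_pos => //; first exact: vadd_ge0.
by apply: vadd_disjoint_le => //; exact: vpos_meet.
Qed.

(** A first bound, from the real and imaginary parts of [z / k]. *)
Lemma image_crude k z e : 0 < k -> B (creal e) -> modulus z <=v k *: e ->
  modulus (f z) <=v (2 * k) *: modulus (f (creal e)).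
Proof.
move=> k0 Be ze; have kV0 : 0 <= k^-1 by rewrite invr_ge0 ltW.
pose y := (k^-1)%:C%C *: z; have ye : modulus y <=v e.
  by rewrite /y modulusZr ger0_norm// vle_scaleV.
have -> : z = k%:C%C *: y.
  by rewrite /y scalerA -rmorphM/= divff ?gt_eqF// scale1r.
rewrite linearZ modulusZr ger0_norm ?ltW// mulrC -scalerA.
apply: vle_scale; first exact: ltW.
rewrite (creal_decomp y) linearD linearZ.
apply: vtrans (ler_modulusD _ _) _; rewrite modulusZi scaler_nat mulr2n.
by apply: vleD; apply: image_mono_real => //; apply: vtrans ye;
  [exact: modulus_fst|exact: modulus_snd].
Qed.

Definition near_image s z :=
  let u := modulus (f z) in let v := modulus (f (creal (modulus z))) in
  (u <=v v + (6 * s) *: v) && (v <=v u + (6 * s) *: v).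

(** Over a small square [z] is close to [g |z|] for a constant [g]. The error
    of the image is at most [4 s] by [image_crude] and [g] has modulus one up to
    [2 s]. *)
Lemma near_image_cell k l s z : 0 < s -> B z -> cell k l s s z ->
  near_image s z.
Proof.
move=> s0 Bz /cell_near; set e := modulus z; set g := (k +i* l)%C.
have Be : B (creal e) by apply: Bs Bz; rewrite modulus_modulus vle_refl.
have e0 : 0 <=v e := modulus_ge0 z.
set d := z - g *: creal e => dz.
have dE : z = g *: creal e + d by rewrite /d addrC subrK.
have ds : modulus (f d) <=v (2 * (s + s)) *: modulus (f (creal e)).
  by apply: image_crude; rewrite ?addr_gt0.
have [ez|en] := eqVneq e 0.
  have z0 : z = 0 by exact: modulus_eq0.
  have c0 : creal 0 = 0 :> X by [].
  by rewrite /near_image -/e ez z0 c0 !linear0 modulus0 scaler0 addr0 vle_refl.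
have cmp (p q : R) : p *: e <=v q *: e -> p <= q.
  move=> pq; rewrite leNgt; apply/negP => qp; move/eqP: en; apply.
  apply: vle_anti; rewrite e0 andbT -(scaler0 _ (p - q)^-1).
  rewrite -vle_scaleV ?invr_gt0 ?subr_gt0// invrK.
  by rewrite scalerBl vle_subl add0r.
set G := complex.Re `|g|.
have gE : modulus (g *: creal e) = G *: e by rewrite modulusZ modulus_pos.
have g1 : G <= 1 + (s + s).
  apply: cmp; rewrite -gE scalerDl scale1r.
  apply: vtrans (modulus_le_add _ d) _.
  by rewrite -dE; apply: vleD => //; exact: vle_refl.
have g2 : 1 <= G + (s + s).
  apply: cmp; rewrite scale1r scalerDl -gE {1}/e {1}dE.
  apply: vtrans (ler_modulusD _ _) _.
  by apply: vleD => //; exact: vle_refl.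
set v := modulus (f (creal e)); have v0 : 0 <=v v := modulus_ge0 _.
have fE : f z = g *: f (creal e) + f d by rewrite {1}dE linearD linearZ.
rewrite /near_image -/e -/v; apply/andP; split.
  rewrite -{1}(scale1r v) -scalerDl fE; apply: vtrans (ler_modulusD _ _) _.
  rewrite modulusZ -/G -/v; apply: vtrans (vleD (vle_refl _) ds) _.
  by rewrite -/v -scalerDl; apply: vle_scalel => //; lra.
have : G *: v <=v modulus (f z) + (2 * (s + s)) *: v.
  rewrite -[G *: v]modulusZ; apply: vtrans (modulus_le_add _ (f d)) _.
  by rewrite -fE vleDl.
move=> h; rewrite -vle_subl -{1}(scale1r v) -scalerBl.
move: h; rewrite -vle_subl -scalerBl; apply: vtrans.
by apply: vle_scalel => //; lra.
Qed.

Lemma near_image_glue D s z : B z -> near_image s (proj D z) ->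
  near_image s (z - proj D z) -> near_image s z.
Proof.
rewrite /near_image => Bz.
have Bm : B (creal (modulus z)).
  by apply: Bs Bz; rewrite modulus_modulus vle_refl.
rewrite (modulus_image D Bz) (modulus_image D Bm) proj_modulus -crealB.
rewrite -modulus_subproj => /andP[a1 a2] /andP[b1 b2].
by rewrite scalerDr; apply/andP; split; rewrite addrACA; exact: vleD.
Qed.

Lemma near_image_all n k l s z : 0 < s -> B z ->
  cell k l (s *+ 2 ^ n) (s *+ 2 ^ n) z -> near_image s z.
Proof.
move=> s0; elim: n k l z => [|n IH] k l z Bz.
  by rewrite expn0 mulr1n; exact: near_image_cell.
rewrite expnS mul2n -addnn mulrnDr => /cell_halve1[D [c1 c2]].
have B1 := solid_proj D Bz; have B2 := solid_subproj D Bz.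
apply: (@near_image_glue D) => //.
  have [D1 [c3 c4]] := cell_halve2 c1.
  by apply: (@near_image_glue D1) => //;
    apply: IH; [exact: solid_proj|exact: c3|exact: solid_subproj|exact: c4].
have [D1 [c3 c4]] := cell_halve2 c2.
by apply: (@near_image_glue D1) => //;
  apply: IH; [exact: solid_proj|exact: c3|exact: solid_subproj|exact: c4].
Qed.

(** Cut [z] into finitely many disjoint pieces of nearly constant phase, and
    refine the pieces. *)
Lemma image_modulus z : B z -> modulus (f z) = modulus (f (creal (modulus z))).
Proof.
move=> Bz; have near s : 0 < s -> exists2 t, 0 < t <= s & near_image t z.
  move=> s0; have [n ns] : exists n, 2^-1 ^+ n * 2 <= s.
    by apply: geometric_small; rewrite ?invr_ge0 ?invf_lt1// ltr1n.
  have t0 : 0 < (2^-1 : R) ^+ n * 2 by rewrite mulr_gt0// exprn_gt0// invr_gt0.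
  exists (2^-1 ^+ n * 2); first by rewrite t0.
  apply: (@near_image_all n (-1) (-1)) => //.
  have -> : (2^-1 ^+ n * 2) *+ (2 ^ n) = 2 :> R.
    rewrite -[LHS]mulr_natr natrX mulrAC -exprMn mulVf ?pnatr_eq0//.
    by rewrite expr1n mul1r.
  exact: cell_init.
set v := modulus (f (creal _)); have v0 : 0 <=v v := modulus_ge0 _.
have key d : 0 < d -> exists2 t, `|(6 * t) *: v| <= d & near_image t z.
  move=> d0; have d1 : 0 < d / (6 * (`|v| + 1)).
    by rewrite divr_gt0// mulr_gt0// ltr_wpDl.
  have [t /andP[t0 td] nt] := near _ d1.
  exists t => //; rewrite normrZ ger0_norm ?mulr_ge0 ?(ltW t0)//.
  apply: (@le_trans _ _ (6 * t * (`|v| + 1))).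
    by rewrite ler_wpM2l ?mulr_ge0 ?(ltW t0)// lerDl.
  rewrite mulrAC mulrC -ler_pdivlMr// mulr_gt0// ltr_wpDl//.
apply: vle_anti; apply/andP.
by split; apply: vle_lim => d /key[t td /andP[? ?]]; exists ((6 * t) *: v).
Qed.

(** The phases of [x] and [z] being irrelevant by [image_modulus], positive
    elements can be compared instead. *)
Lemma image_mono x z : B z -> modulus x <=v modulus z ->
  modulus (f x) <=v modulus (f z).
Proof.
move=> Bz xz; have Bx : B x by apply: Bs Bz.
rewrite (image_modulus Bx) (image_modulus Bz); apply: image_mono_pos => //.
  by apply: Bs Bz; rewrite modulus_modulus vle_refl.
exact: modulus_ge0.
Qed.

End Monotone.
End DisjointnessPreserving.

(** * Disjointness preserving bijections and their powers *)

Section Powers.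
Context {R : realType} {E : dedekindBanachLatticeType R}.
Local Notation X := (complexification E).
Implicit Types (f g h : {linear X -> X}) (x y z : X) (D G : set X).

Definition opow f n : X -> X := iter n f.
Arguments opow : simpl never.

Lemma opowS f n x : opow f n.+1 x = f (opow f n x).
Proof. by []. Qed.

Lemma opow_linear f n : linear (opow f n).
Proof. by elim: n => // n IH u x y; rewrite !opowS IH linearP. Qed.

HB.instance Definition _ f n :=
  GRing.isLinear.Build R[i]%C X X *:%R (opow f n) (@opow_linear f n).

Lemma opowSr f n x : opow f n.+1 x = opow f n (f x).
Proof. exact: iterSr. Qed.

Lemma opowD f m n x : opow f (m + n) x = opow f m (opow f n x).
Proof. exact: iterD. Qed.

Lemma opowK f g n : cancel f g -> cancel (opow f n) (opow g n).
Proof.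
by move=> fK; elim: n => // n IH x; rewrite (opowSr g) (opowS f) fK IH.
Qed.

Lemma rnorm_bounded_pow f n : rnorm_bounded f -> rnorm_bounded (opow f n).
Proof.
move=> [K K0 fK]; elim: n => [|n [L L0 fL]].
  by exists 1 => // x; rewrite mul1r.
exists (K * L); first exact: mulr_ge0.
move=> x.
by rewrite opowS; apply: le_trans (fK _) _; rewrite -mulrA ler_wpM2l.
Qed.

Record disj_iso f g : Prop := DisjIso {
  disj_iso_bounded : rnorm_bounded f;
  disj_iso_boundedV : rnorm_bounded g;
  disj_isoK : cancel f g;
  disj_isoKV : cancel g f;
  disj_isoE : forall x y, disj (f x) (f y) <-> disj x y }.

Lemma disj_iso_mono f g x y : disj_iso f g ->
  modulus x <=v modulus y -> modulus (f x) <=v modulus (f y).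
Proof.
move=> fg; apply: (@image_mono _ _ _ setT) => //.
  exact: disj_iso_bounded fg.
by move=> a b _ _ /(disj_isoE fg).
Qed.

(** By monotonicity the image of [|x| /\ |y|] lies below the images of [x] and
    [y], which are disjoint, and hence vanishes. *)
Lemma disj_isoI f g : rnorm_bounded f -> rnorm_bounded g -> cancel f g ->
  cancel g f -> disj_preserving setT f -> disj_iso f g.
Proof.
move=> fb gb fgK gfK fd; split => // x y; split; last exact: fd.
move=> fxy; set m := vmeet (modulus x) (modulus y).
have m0 : 0 <=v m by rewrite vmeet_ge0 ?modulus_ge0.
have mono z : m <=v modulus z -> modulus (f (creal m)) <=v modulus (f z).
  by move=> mz; apply: (image_mono fb _ fd) => //; rewrite modulus_pos.
have : disj (f (creal m)) (f (creal m)).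
  apply: disj_le (mono x (vmeet_lel _ _)) _; apply: disjC.
  by apply: disj_le (mono y (vmeet_ler _ _)) _; apply: disjC.
move=> /disj_self fm; rewrite /disj -/m.
have : creal m = 0 by rewrite -(fgK (creal m)) fm linear0.
by case.
Qed.

Lemma disj_iso_sym f g : disj_iso f g -> disj_iso g f.
Proof.
case=> fb gb fK gK fd; split => // x y.
by rewrite -{2}(gK x) -{2}(gK y); split => /fd.
Qed.

Lemma disj_iso_pow n f g : disj_iso f g -> disj_iso (opow f n) (opow g n).
Proof.
case=> fb gb fK gK fd; split.
- exact: rnorm_bounded_pow.
- exact: rnorm_bounded_pow.
- exact: opowK.
- exact: opowK.
- by elim: n => // n IH x y; rewrite /= !opowS; split => [/fd/IH|/IH/fd].
Qed.

Definition dominated f h :=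
  exists2 c : R, 0 <= c & forall x, modulus (h x) <=v c *: modulus (f x).

Lemma dominated_disj f h x y : dominated f h -> disj (f x) y -> disj (h x) y.
Proof. by case=> c c0 fh; apply: disj_sub c0 _. Qed.

Lemma dominated_bounded f h :
  rnorm_bounded f -> dominated f h -> rnorm_bounded h.
Proof.
move=> [K K0 fK] [c c0 fh]; exists (c * K); first exact: mulr_ge0.
move=> x; apply: le_trans (vle_norm_ge0 (modulus_ge0 _) (fh x)) _.
by rewrite normrZ ger0_norm// -mulrA ler_wpM2l//; exact: fK.
Qed.

Lemma dominated_pow n f g h : disj_iso f g -> dominated f h ->
  dominated (opow f n) (opow h n).
Proof.
move=> fg [c c0 fh]; elim: n => [|n [d d0 IH]].
  by exists 1 => // x; rewrite scale1r vle_refl.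
exists (c * d); first exact: mulr_ge0.
move=> x; rewrite /= !opowS; apply: vtrans (fh _) _.
rewrite -scalerA; apply: vle_scale => //.
rewrite -[d in X in _ <=v X]ger0_norm// -modulusZr -linearZ.
by apply: (disj_iso_mono fg); rewrite modulusZr ger0_norm ?IH.
Qed.

Lemma image_dcompl f g D x :
  disj_iso f g -> dcompl D x -> dcompl (f @` D) (f x).
Proof. by move=> fg xD _ [d dD <-]; apply/(disj_isoE fg); exact: xD. Qed.

Lemma image_dcompl2 f g D x : disj_iso f g ->
  dcompl (dcompl D) x -> dcompl (dcompl (f @` D)) (f x).
Proof.
move=> fg xD y yD; rewrite -(disj_isoKV fg y); apply/(disj_isoE fg).
apply: xD => d dD; apply/(disj_isoE fg); rewrite (disj_isoKV fg).
by apply: yD; exists d.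
Qed.

Lemma dominated_dcompl f h D x :
  dominated f h -> dcompl D (f x) -> dcompl D (h x).
Proof. by move=> fh fxD d dD; apply: dominated_disj fh _; exact: fxD. Qed.

Lemma proj_image f g h D x : disj_iso f g -> dominated f h ->
  proj (f @` D) (h x) = h (proj D x).
Proof.
move=> fg fh; apply: proj_uniq.
  by apply: dominated_dcompl fh _; apply: image_dcompl2 fg _; exact: proj_in.
rewrite -linearB; apply: dominated_dcompl fh _; apply: image_dcompl fg _.
exact: proj_out.
Qed.

End Powers.

(** * Recurrent and antiperiodic bands *)

Section Wandering.
Context {R : realType} {E : dedekindBanachLatticeType R}.
Local Notation X := (complexification E).
Implicit Types (x y z : X) (D G : set X).
Variables (S S' : {linear X -> X}).
Hypothesis SS' : disj_iso S S'.

Definition wandering k : set X := [set c | disj c (opow S k c)].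

(** By [recurrent_local] this is a band on which [S ^ k] acts locally. *)
Definition recurrent k : set X := dcompl (wandering k).

Lemma wandering_le k x y : modulus x <=v modulus y ->
  wandering k y -> wandering k x.
Proof.
move=> xy yW; apply: (disj_le xy); apply: disjC.
by apply: disj_le (disj_iso_mono (disj_iso_pow k SS') xy) _; apply: disjC.
Qed.

Lemma wandering_S k x : wandering k x -> wandering k (S x).
Proof.
by move=> xW; rewrite /wandering/= -opowSr opowS; apply/(disj_isoE SS').
Qed.

Lemma wandering_S' k x : wandering k x -> wandering k (S' x).
Proof.
move=> xW; rewrite /wandering/=; apply/(disj_isoE SS').
by rewrite -opowS opowSr !(disj_isoKV SS').
Qed.

Lemma dcompl_invariant G x :
  (forall y, G y -> G (S' y)) -> dcompl G x -> dcompl G (S x).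
Proof.
move=> GS xG y /GS Gy; rewrite -(disj_isoKV SS' y); apply/(disj_isoE SS').
exact: xG.
Qed.

Lemma dcompl_invariantV G x :
  (forall y, G y -> G (S y)) -> dcompl G x -> dcompl G (S' x).
Proof.
move=> GS xG y /GS Gy; apply/(disj_isoE SS'); rewrite (disj_isoKV SS').
exact: xG.
Qed.

Lemma recurrent_S k x : recurrent k x -> recurrent k (S x).
Proof. by apply: dcompl_invariant => y; exact: wandering_S'. Qed.

Lemma recurrent_S' k x : recurrent k x -> recurrent k (S' x).
Proof. by apply: dcompl_invariantV => y; exact: wandering_S. Qed.

(** If [S ^ k x] had a part in the band of some [y] disjoint from [x], the
    preimage of this part would be a wandering element below [x]. *)
Lemma recurrent_local k x y :
  recurrent k x -> disj x y -> disj (opow S k x) y.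
Proof.
move=> xF xy; have Sk := disj_iso_pow k SS'.
set m := vmeet (modulus (opow S k x)) (modulus y).
have m0 : 0 <=v m by rewrite vmeet_ge0 ?modulus_ge0.
pose c := opow S' k (creal m).
have Sc : opow S k c = creal m by exact: (disj_isoKV Sk).
have cx : modulus c <=v modulus x.
  rewrite -(disj_isoK Sk x); apply: (disj_iso_mono (disj_iso_sym Sk)).
  by rewrite modulus_pos// vmeet_lel.
have cW : wandering k c.
  apply: (disj_le cx); apply: disjC; rewrite Sc; apply: disj_le (disjC xy).
  by rewrite modulus_pos// vmeet_ler.
have : disj c c by apply: (disj_le cx); exact: xF.
move=> /disj_self c0; have := Sc; rewrite c0 linear0 => -[] e.
by rewrite /disj -/m -e.
Qed.

(** No power [S ^ k], [0 < k <= n], is local on a nonzero part of this band. *)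
Definition antiperiodic n : set X :=
  [set x | forall k, (0 < k <= n)%N -> dcompl (recurrent k) x].

Lemma antiperiodic_le n x y : modulus x <=v modulus y ->
  antiperiodic n y -> antiperiodic n x.
Proof. by move=> xy yH k kn; apply: (dcompl_le xy); exact: yH. Qed.

Definition free_set n D :=
  forall d d' k, D d -> D d' -> (0 < k <= n)%N -> disj d (opow S k d').

(** Meet [x] with suitable wandering elements for [S], [S ^ 2], ... in turn. *)
Lemma antiperiodic_free n x : antiperiodic n x -> x != 0 ->
  exists c, [/\ c != 0, modulus c <=v modulus x & free_set n [set c]].
Proof.
elim: n => [|n IH] xH x0.
  by exists x; split => // [|d d' k _ _]; [exact: vle_refl|case: k].
have [k /andP[k0 kn]|c [c0 cx cV]] := IH _ x0.
  by apply: xH; rewrite k0 ltnW.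
have cF : dcompl (recurrent n.+1) c.
  by apply: (dcompl_le cx); apply: xH; rewrite ltnSn.
have : ~ recurrent n.+1 c.
  by move=> /cF/disj_self; apply/eqP.
move=> /existsNP[w /not_implyP[wW cw]].
pose h := vmeet (modulus c) (modulus w).
have h0 : 0 <=v h by rewrite vmeet_ge0 ?modulus_ge0.
have hc : modulus (creal h) <=v modulus c by rewrite modulus_pos// vmeet_lel.
have hw : modulus (creal h) <=v modulus w by rewrite modulus_pos// vmeet_ler.
exists (creal h); split.
- by apply/eqP => -[].
- exact: vtrans hc cx.
move=> _ _ k -> -> /andP[k0]; rewrite leq_eqVlt => /predU1P[->|].
  exact: (wandering_le hw).
rewrite ltnS => kn; apply: (wandering_le hc).
by apply: cV => //; rewrite k0.
Qed.

Lemma free_set_shift n t D : free_set n D -> free_set n (opow S' t @` D).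
Proof.
move=> DV _ _ k [d dD <-] [d' dD' <-] kn; have St := disj_iso_pow t SS'.
apply/(disj_isoE St); rewrite /= -opowD addnC opowD.
rewrite !(opowK _ (disj_isoKV SS')); exact: DV.
Qed.

(** Disjointness passes from the elements of [D] to the band, by taking double
    complements on one side at a time. *)
Lemma free_set_band n D x y k : free_set n D ->
  dcompl (dcompl D) x -> dcompl (dcompl D) y -> (0 < k <= n)%N ->
  disj x (opow S k y).
Proof.
move=> DV xD yD kn; have Sk := disj_iso_pow k SS'.
apply: disjC; apply: (image_dcompl2 Sk yD) => _ [d dD <-]; apply: xD => d' dD'.
by apply: disjC; exact: DV.
Qed.

(** A Rokhlin type covering. A maximal free set and its [2 n] nearest
    translates fill the antiperiodic band, since a free element disjoint from
    all of them could be adjoined to it. The parameter [t] translates the base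
    of the tower. *)
Lemma free_cover n t : exists2 D, free_set n D &
  forall x, antiperiodic n x ->
    (forall i, (i <= n + n)%N -> dcompl (opow S (t + i) @` D) x) -> x = 0.
Proof.
have [D [DV Dmax]] : exists A, free_set n A /\
    forall B, A `<` B -> ~ free_set n B.
  apply: Zorn_bigcup => F FV Ftot d d' k [A FA dA] [B FB dB] kn.
  by have [AB|BA] := Ftot _ _ FA FB;
    [apply: (FV _ FB) => //; exact: AB|apply: (FV _ FA) => //; exact: BA].
(* going [n] levels down as well makes all the indices nonnegative *)
exists (opow S' (t + n) @` D); first exact: free_set_shift.
move=> x xH xD; apply/eqP/negPn/negP => x0.
have [c [c0 cx cV]] := antiperiodic_free xH x0.
have cD i d : (i <= n + n)%N -> D d ->
    disj c (opow S i (opow S' n d)).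
  move=> i2n dD; apply: (disj_le cx); apply: (xD i i2n).
  exists (opow S' (t + n) d); first by exists d.
  by rewrite addnC opowD [opow S' (t + n) d]opowD (opowK _ (disj_isoKV SS')).
have cDS k d : (k <= n)%N -> D d -> disj c (opow S k d).
  move=> kn dD; have := cD (k + n)%N d; rewrite leq_add2r => /(_ kn dD).
  by rewrite opowD (opowK _ (disj_isoKV SS')).
have cDS' k d : (k <= n)%N -> D d -> disj d (opow S k c).
  move=> kn dD; apply: disjC.
  have Sk := disj_iso_pow k SS'; rewrite -(disj_isoKV Sk d).
  apply/(disj_isoE Sk) => /=; have := cD (n - k)%N d.
  rewrite (leq_trans (leq_subr _ _) (leq_addr _ _)) => /(_ isT dD).
  by rewrite -{2}(subnK kn) opowD (opowK _ (disj_isoKV SS')).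
have Dc : ~ D c.
  by move=> /(cDS 0 _ (leq0n n))/disj_self; exact/eqP.
apply: (Dmax (D `|` [set c])).
  split; first by move=> d; left.
  by move=> /(_ c (or_intror erefl)).
move=> d d' k [dD|->] [dD'|->] /[dup] kn /andP[k0 kn'].
- exact: DV.
- exact: cDS'.
- exact: cDS.
- exact: cV.
Qed.

End Wandering.

(** * Coverings, and lower estimates on approximating subspaces *)

Section Cover.
Context {R : realType} {E : dedekindBanachLatticeType R}.
Local Notation X := (complexification E).
Implicit Types (x y z : X) (D G : set X).

Lemma vle_sum n (F : 'I_n -> E) i :
  (forall j, 0 <=v F j) -> F i <=v \sum_j F j.
Proof.
move=> F0; rewrite (bigD1 i)//=; apply: vle_addr.
by elim/big_ind: _ => //; [exact: vle_refl|exact: vadd_ge0].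
Qed.

(** The part of [|x|] exceeding the sum of the projections is disjoint from
    all the bands. *)
Lemma proj_cover n (D : nat -> set X) x :
  (forall z, modulus z <=v modulus x ->
    (forall i, (i < n)%N -> dcompl (D i) z) -> z = 0) ->
  rnorm x <= \sum_(i < n) rnorm (proj (D i) x).
Proof.
move=> cov; pose s := \sum_(i < n) modulus (proj (D i) x).
pose g := vjoin (modulus x - s) 0; have g0 : 0 <=v g := vle_joinr _ _.
have s0 : 0 <=v s.
  rewrite /s; elim/big_ind: _ => [|? ?|i _]; first exact: vle_refl.
    exact: vadd_ge0.
  exact: modulus_ge0.
have : creal g = 0.
  apply: cov => [|i ni]; first rewrite modulus_pos//.
    apply: vjoin_lub; last exact: modulus_ge0.
    by rewrite vle_subl vle_addr.
  apply: (dcompl_le _ (proj_out (D i) x)); rewrite modulus_pos//.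
  apply: vjoin_lub; last exact: modulus_ge0.
  rewrite modulus_subproj vleDl vleN.
  by apply: (@vle_sum n (fun j => modulus (proj (D j) x)) (Ordinal ni)) => j;
    exact: modulus_ge0.
case=> ge; have xs : modulus x <=v s.
  by rewrite -[s]add0r -vle_subl -ge vle_joinl.
apply: le_trans (vle_norm_ge0 (modulus_ge0 x) xs) _.
exact: ler_norm_sum.
Qed.

Lemma proj_cover_bound n (D : nat -> set X) x M :
  (forall z, modulus z <=v modulus x ->
    (forall i, (i < n)%N -> dcompl (D i) z) -> z = 0) ->
  (forall i, (i < n)%N -> rnorm (proj (D i) x) <= M) -> rnorm x <= n%:R * M.
Proof.
move=> /proj_cover cov bnd; apply: le_trans cov _.
rewrite -[n in n%:R]card_ord mulr_natl -sumr_const.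
by apply: ler_sum => i _; exact: bnd.
Qed.

(** The component [p] of [y] in the band has a modulus close to [|z|] and
    differs little from [y], and [f] only sees [|p|] and [|z|]. *)
Lemma aim_image (f : {linear X -> X}) G K e y z :
  0 <= K -> (forall x, rnorm (f x) <= K * rnorm x) ->
  disj_preserving (dcompl G) f -> dcompl G z -> `|modulus z - modulus y| <= e ->
  `|rnorm (f z) - rnorm (f y)| <= K * e + K * e.
Proof.
move=> K0 fK fd zG zye; have fb : rnorm_bounded f by exists K.
pose q := proj G y; pose p := y - q.
have yE : y = p + q by rewrite subrK.
have pG : dcompl G p := proj_out G y.
have qG : dcompl (dcompl G) q := proj_in G y.
clearbody p q.
have img x : dcompl G x -> rnorm (f x) = rnorm (f (creal (modulus x))).
  by move=> xG; rewrite /rnorm (image_modulus fb (@dcompl_solid _ _ G) fd).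
have dG x : dcompl G x -> dcompl G (creal (modulus x)).
  by apply: dcompl_le; rewrite modulus_modulus vle_refl.
have dqG : dcompl (dcompl G) (creal (modulus q)).
  by apply: (dcompl_le _ qG); rewrite modulus_modulus vle_refl.
have dd : disj (creal (modulus z) - creal (modulus p)) (- creal (modulus q)).
  apply: disjC; rewrite -scaleN1r; apply: disjZ.
  by apply: dqG; apply: dcomplB; exact: dG.
have ze : creal (modulus z) - creal (modulus p) - creal (modulus q) =
    creal (modulus z - modulus y).
  rewrite -!crealB [in RHS]yE modulusD; last by apply: disjC; exact: qG.
  by rewrite opprD addrA.
have e1 : rnorm (creal (modulus z) - creal (modulus p)) <= e.
  by apply: le_trans (rnorm_leDl dd) _; rewrite ze rnorm_creal.
have e2 : rnorm q <= e.
  have -> : rnorm q = rnorm (- creal (modulus q)).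
    by rewrite rnormN /rnorm modulus_modulus.
  by apply: le_trans (rnorm_leDr dd) _; rewrite ze rnorm_creal.
have f1 : `|rnorm (f z) - rnorm (f p)| <= K * e.
  rewrite (img z)// (img p)//.
  set a := creal _; set b := creal _ in e1 *.
  have h u v : rnorm (u - v) <= e -> rnorm (f u) - rnorm (f v) <= K * e.
    move=> uv; rewrite lerBlDl; apply: le_trans (rnorm_le_sub _ (f v)) _.
    by rewrite lerD2l -linearB; apply: le_trans (fK _) _; rewrite ler_wpM2l.
  rewrite ler_norml lerNl opprB; apply/andP; split; apply: h => //.
  by rewrite -rnormN opprB.
have f2 : `|rnorm (f p) - rnorm (f y)| <= K * e.
  have fq : rnorm (f q) <= K * e by apply: le_trans (fK _) _; rewrite ler_wpM2l.
  rewrite yE linearD ler_norml lerNl opprB; apply/andP; split.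
    by rewrite lerBlDl; apply: le_trans (rnormD _ _) _; rewrite lerD2l.
  rewrite lerBlDl; apply: le_trans (rnorm_le_sub _ (f p + f q)) _.
  by rewrite lerD2l opprD addrA subrr add0r rnormN.
rewrite -(subrKA (rnorm (f p))).
by apply: le_trans (ler_normD _ _) _; exact: lerD.
Qed.

Lemma aim_lower (f h : {linear X -> X}) (Y : set X) G (c : R) :
  aim_subspace Y -> 0 <= c -> rnorm_bounded f -> rnorm_bounded h ->
  disj_preserving (dcompl G) f -> disj_preserving (dcompl G) h ->
  (forall y, Y y -> c * rnorm (f y) <= rnorm (h y)) ->
  forall z, dcompl G z -> c * rnorm (f z) <= rnorm (h z).
Proof.
move=> [_ _ aim] c0 [K K0 fK] [L L0 hL] fd hd low z zG.
apply/ler_addgt0Pr => e e0.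
pose M := c * (K + K) + (L + L) + 1.
have M0 : 0 < M by rewrite ltr_wpDl// !addr_ge0// mulr_ge0// addr_ge0.
have [y Yy zy] := aim z (e / M) (ltac:(by rewrite divr_gt0)).
have := aim_image K0 fK fd zG zy; have := aim_image L0 hL hd zG zy.
rewrite !ler_norml => /andP[h1 _] /andP[_ f1].
have := low y Yy; set d := e / M in h1 f1 *.
have d0 : 0 < d by rewrite divr_gt0.
have eE : e = M * d by rewrite /d mulrC divfK ?gt_eqF.
have : c * rnorm (f z) <= c * rnorm (f y) + c * (K * d + K * d).
  by rewrite -mulrDr ler_wpM2l// -lerBlDl.
have : rnorm (h y) <= rnorm (h z) + (L * d + L * d) by lra.
have : M * d = c * (K * d + K * d) + (L * d + L * d) + d.
  by rewrite /M; ring.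
by rewrite eE; lra.
Qed.

End Cover.

(** * Polynomials in an operator *)

(** By the Bernoulli inequality one of the two factors [(1 + h) ^- m] absorbs
    the linear term. *)
Lemma linear_geometric_small {R : realType} (h C e : R) :
  0 < h -> 0 <= C -> 0 < e ->
  exists m, (4 * m + 3)%:R * C * ((1 + h) ^+ 2)^-1 ^+ m <= e.
Proof.
move=> h0 C0 e0; have h1 : 1 < 1 + h by rewrite ltrDl.
have hV0 : 0 < (1 + h)^-1 by rewrite invr_gt0; lra.
have bern m : 1 + m%:R * h <= (1 + h) ^+ m.
  elim: m => [|m IH]; first by rewrite mul0r addr0 expr0.
  rewrite exprS -natr1; apply: (@le_trans _ _ ((1 + h) * (1 + m%:R * h))).
    have : 0 <= m%:R * h * h by rewrite !mulr_ge0// ltW.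
    by rewrite !mulrDl !mulrDr; lra.
  by rewrite ler_wpM2l//; lra.
pose M := 3 + 4 / h.
have [m me] := @geometric_small _ (1 + h)^-1 (M * C) e (ltW hV0)
  (ltac:(by rewrite invf_lt1//; lra)) e0.
exists m; apply: le_trans me; set r := (1 + h)^-1 ^+ m.
have -> : ((1 + h) ^+ 2)^-1 ^+ m = r * r.
  by rewrite -exprVn -exprM mulnC exprM expr2.
rewrite mulrA.
have r0 : 0 < r by rewrite exprn_gt0.
rewrite [leLHS]mulrC; apply: ler_wpM2l; first exact: ltW.
rewrite [leLHS]mulrAC; apply: ler_wpM2r => //.
rewrite /r exprVn ler_pdivrMr ?exprn_gt0//; last lra.
apply: (@le_trans _ _ (M * (1 + m%:R * h))); last first.
  by rewrite ler_wpM2l// addr_ge0// divr_ge0// ltW.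
have -> : (4 * m + 3)%:R = 4 * m%:R + 3 :> R by rewrite natrD natrM.
have -> : M * (1 + m%:R * h) = 3 + 4 / h + 3 * m%:R * h + 4 * m%:R.
  by rewrite /M; field; rewrite gt_eqF.
have : 0 <= 4 / h by rewrite divr_ge0// ltW.
have : 0 <= 3 * m%:R * h by rewrite !mulr_ge0// ltW.
lra.
Qed.

Section Polynomials.
Context {R : realType} {E : dedekindBanachLatticeType R}.
Local Notation X := (complexification E).
Implicit Types (f : {linear X -> X}) (x y z : X) (D G : set X) (a b : nat -> R).

Definition opoly a n f x : X := \sum_(k < n) (a k)%:C%C *: opow f k x.

Lemma opoly_linear a n f : linear (opoly a n f).
Proof.
move=> u x y; rewrite /opoly scaler_sumr -big_split/=; apply: eq_bigr => k _.
by rewrite linearP scalerDr !scalerA mulrC.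
Qed.

HB.instance Definition _ a n f :=
  GRing.isLinear.Build R[i]%C X X *:%R (opoly a n f) (@opoly_linear a n f).

Lemma opolyS a n f x :
  opoly a n.+1 f x = opoly a n f x + (a n)%:C%C *: opow f n x.
Proof. by rewrite /opoly big_ord_recr. Qed.

Lemma image_opoly a n f x :
  f (opoly a n f x) = \sum_(k < n) (a k)%:C%C *: opow f k.+1 x.
Proof.
by rewrite /opoly linear_sum; apply: eq_bigr => k _; rewrite linearZ.
Qed.

(** At [k = 0] the difference [a k - a k.-1] vanishes. *)
Lemma opoly_telescope a n f x :
  opoly a n.+1 f x - f (opoly a n.+1 f x) =
  (a 0%N)%:C%C *: x + opoly (fun k => a k - a k.-1) n.+1 f x
    - (a n)%:C%C *: opow f n.+1 x.
Proof.
elim: n => [|n IH].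
  by rewrite !opolyS /opoly !big_ord0 !add0r subrr scale0r addr0 linearZ.
rewrite opolyS linearD opprD addrACA IH [in RHS]opolyS.
rewrite [f (_ *: _)]linearZ [in RHS](opowS f n.+1) /=.
rewrite rmorphB scalerBl !addrA; congr (_ + _).
by rewrite [LHS]addrAC.
Qed.

Lemma rnorm_bounded_opoly a n f :
  rnorm_bounded f -> rnorm_bounded (opoly a n f).
Proof.
move=> fb; elim: n => [|n [L L0 IH]].
  by exists 0 => // x; rewrite /opoly big_ord0 rnorm0 mul0r.
have [K K0 fK] := rnorm_bounded_pow n fb.
exists (L + `|a n| * K); first by rewrite addr_ge0// mulr_ge0.
move=> x; rewrite opolyS mulrDl; apply: le_trans (rnormD _ _) _.
by rewrite lerD// rnormZ norm_real -mulrA ler_wpM2l.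
Qed.

(** On disjoint iterates the modulus of a combination is the combination of the
    moduli, hence monotone in the coefficients. *)
Lemma modulus_opoly_le a b n f x e : 0 <= e ->
  (forall k, (k < n)%N -> `|b k| <= e * `|a k|) ->
  (forall j k, (j < k < n)%N -> disj (opow f j x) (opow f k x)) ->
  modulus (opoly b n f x) <=v e *: modulus (opoly a n f x).
Proof.
move=> e0; elim: n => [|n IH] ba dis.
  by rewrite /opoly !big_ord0 modulus0 scaler0 vle_refl.
rewrite !opolyS; apply: vtrans (ler_modulusD _ _) _.
rewrite [X in _ <=v _ *: X]modulusD; last first.
  apply: disj_sum => i; apply: disjZ; apply: disjC; apply: disjZ; apply: disjC.
  by apply: dis; rewrite ltn_ord ltnSn.
rewrite scalerDr; apply: vleD.
  apply: IH => [k kn|j k /andP[jk kn]]; first by apply: ba; exact: ltnW.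
  by apply: dis; rewrite jk ltnW.
rewrite !modulusZr scalerA; apply: vle_scalel; last exact: modulus_ge0.
exact: ba.
Qed.

Lemma rnorm_opow_le_opoly a n m f x : (m < n)%N -> a m = 1 ->
  (forall j k, (j < n)%N -> (k < n)%N -> j != k ->
    disj (opow f j x) (opow f k x)) ->
  rnorm (opow f m x) <= rnorm (opoly a n f x).
Proof.
move=> mn am dis; rewrite /opoly (bigD1 (Ordinal mn))//= am scale1r.
apply: rnorm_leDl; apply: disjC.
elim/big_ind: _ => [|? ?|i im]; [exact: disj0|exact: disjD|].
by apply: disjZ; apply: dis.
Qed.

Lemma opow_near f n : rnorm_bounded f -> exists2 C : R, 0 <= C &
  forall x, rnorm (x - opow f n x) <= C * rnorm (x - f x).
Proof.
move=> [K K0 fK]; elim: n => [|n [C C0 IH]].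
  by exists 0 => // x; rewrite subrr rnorm0 mul0r.
exists (1 + K * C); first by rewrite addr_ge0// mulr_ge0.
move=> x; rewrite opowS -(subrKA (f x)) -linearB.
apply: le_trans (rnormD _ _) _; rewrite mulrDl mul1r lerD2l -mulrA.
by apply: le_trans (fK _) _; rewrite ler_wpM2l.
Qed.

End Polynomials.

(** * Extension of lower estimates *)

(** A weight on the naturals with peak [1] at [m], decreasing geometrically on
    both sides. *)
Definition peak {R : realType} (q : R) m k : R := q ^+ ((k - m) + (m - k)).

Lemma peak_step {R : realType} (q e : R) m k : 0 < q <= 1 -> 1 - q <= e * q ->
  `|peak q m k - peak q m k.-1| <= e * `|peak q m k|.
Proof.
move=> /andP[q0 q1] qe; have r0 r : 0 <= q ^+ r by rewrite exprn_ge0// ltW.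
have e0 : 0 <= e by rewrite -(pmulr_lge0 e q0); apply: le_trans qe; lra.
rewrite /peak [`|q ^+ _|]ger0_norm//.
case: k => [|k]; first by rewrite subrr normr0 mulr_ge0.
rewrite /=; have [km|mk] := ltnP k m.
  rewrite (eqP km) (eqP (ltnW km)) !add0n -[(m - k)%N]prednK ?subn_gt0//.
  rewrite -subnS; set r := (m - k.+1)%N.
  have -> : q ^+ r - q ^+ r.+1 = (1 - q) * q ^+ r by rewrite exprS; ring.
  rewrite ger0_norm ?mulr_ge0 ?subr_ge0//.
  by apply: ler_wpM2r => //; apply: le_trans qe _; rewrite ler_piMr.
rewrite (eqP mk) (eqP (leqW mk)) !addn0 subSn//; set r := (k - m)%N.
have -> : q ^+ r.+1 - q ^+ r = - ((1 - q) * q ^+ r) by rewrite exprS; ring.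
by rewrite normrN ger0_norm ?mulr_ge0 ?subr_ge0// exprS mulrA ler_wpM2r.
Qed.

Section LowerBound.
Context {R : realType} {E : dedekindBanachLatticeType R}.
Local Notation X := (complexification E).
Implicit Types (x y z : X) (D G : set X) (a b : nat -> R).
Variables (S S' T : {linear X -> X}) (Y : set X) (c : R).
Hypotheses (SS' : disj_iso S S') (ST : dominated S T).
Hypotheses (Yaim : aim_subspace Y) (YT : forall y, Y y -> Y (T y)).
Hypotheses (c0 : 0 < c) (low : forall y, Y y -> c * rnorm y <= rnorm (y - T y)).

Let Tb : rnorm_bounded T := dominated_bounded (disj_iso_bounded SS') ST.

(** Only one of the two elements is moved: two different powers are compared
    by factoring out the smaller one, see [tower_disj]. The condition holds when
    the band is disjoint from its images, and also for a power that is local. *)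
Definition tower n G := forall x y k, dcompl G x -> dcompl G y -> disj x y ->
  (k <= n)%N -> disj (opow S k x) y.

Lemma tower_disj n G x y j k : tower n G ->
  dcompl G x -> dcompl G y -> disj x y ->
  (j <= n)%N -> (k <= n)%N -> disj (opow T j x) (opow T k y).
Proof.
move=> tG xG yG xy jn kn.
apply: (dominated_disj (dominated_pow j SS' ST)); apply: disjC.
apply: (dominated_disj (dominated_pow k SS' ST)).
have main u v p q : dcompl G u -> dcompl G v -> disj u v ->
    (p <= q)%N -> (q <= n)%N -> disj (opow S q u) (opow S p v).
  move=> uG vG uv pq qn; rewrite -(subnKC pq) opowD.
  apply/(disj_isoE (disj_iso_pow p SS')); apply: tG => //.
  exact: leq_trans (leq_subr _ _) qn.
have [jk|kj] := leqP j k; first by apply: main => //; exact: disjC.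
by apply: disjC; apply: main => //; exact: ltnW.
Qed.

Lemma tower_opoly a n G :
  tower n G -> disj_preserving (dcompl G) (opoly a n.+1 T).
Proof.
move=> tG x y xG yG xy; apply: disj_sum => j; apply: disjZ; apply: disjC.
apply: disj_sum => k; apply: disjZ; apply: disjC.
by apply: (tower_disj tG) => //; rewrite -ltnS.
Qed.

Lemma tower_sub_opoly a n G : tower n.+1 G ->
  disj_preserving (dcompl G) (fun x => opoly a n.+1 T x - T (opoly a n.+1 T x)).
Proof.
move=> tG x y xG yG xy.
have dis u v k : dcompl G u -> dcompl G v -> disj u v -> (k <= n.+1)%N ->
    disj (opoly a n.+1 T u - T (opoly a n.+1 T u)) (opow T k v).
  move=> uG vG uv kn; apply: disjD; last rewrite -scaleN1r; last apply: disjZ.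
    apply: disj_sum => j; apply: disjZ.
    by apply: (tower_disj tG) => //; rewrite ltnW.
  rewrite image_opoly; apply: disj_sum => j; apply: disjZ.
  exact: (tower_disj tG).
apply: disjC; apply: disjD; last rewrite -scaleN1r; last apply: disjZ.
  apply: disj_sum => j; apply: disjZ; apply: disjC; apply: dis => //.
  by rewrite ltnW.
rewrite image_opoly; apply: disj_sum => j; apply: disjZ; apply: disjC.
exact: dis.
Qed.

(** Both sides are values of polynomials in [T] that preserve disjointness on
    the band. *)
Lemma lower_opoly a n G z : tower n.+1 G -> dcompl G z ->
  c * rnorm (opoly a n.+1 T z) <=
    rnorm (opoly a n.+1 T z - T (opoly a n.+1 T z)).
Proof.
move=> tG; pose f := opoly a n.+1 T.
have hl : linear (fun x => f x - T (f x)).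
  by move=> u x y; rewrite /f !linearP addrACA -scalerDr.
pose h : {linear X -> X} := HB.pack (fun x => f x - T (f x))
  (GRing.isLinear.Build R[i]%C X X *:%R (fun x => f x - T (f x)) hl).
have fb : rnorm_bounded f by exact: rnorm_bounded_opoly.
have hb : rnorm_bounded h.
  have [K K0 fK] := fb; have [L L0 TL] := Tb.
  exists (K + L * K); first by rewrite addr_ge0// mulr_ge0.
  move=> x /=; apply: le_trans (rnormB _ _) _; rewrite mulrDl lerD//.
  by apply: le_trans (TL _) _; rewrite -mulrA ler_wpM2l.
apply: (@aim_lower _ _ f h Y G c Yaim (ltW c0) fb hb).
- by apply: tower_opoly => x y k xG yG xy kn; apply: tG => //; exact: ltnW.
- exact: tower_sub_opoly.
move=> y Yy; apply: low.
have [[Y0' YP] _ _] := Yaim.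
have Y0 : Y 0 by move: Y0'; rewrite inE.
have Ypow k : Y (opow T k y) by elim: k => // k; exact: YT.
rewrite /= /f /opoly; elim/big_ind: _ => [|u v Yu Yv|k _].
- exact: Y0.
- by have := YP 1 u v; rewrite !inE scale1r; apply.
- have := YP (a k)%:C%C (opow T k y) 0; rewrite !inE addr0.
  by apply; [exact: Ypow|].
Qed.


Lemma free_set_tower n D : free_set S n D -> tower n (dcompl D).
Proof.
move=> DV x y [|k] xD yD xy kn; first exact: xy.
by apply: disjC; apply: (free_set_band SS' DV).
Qed.

Lemma free_set_image n i D : free_set S n D -> free_set S n (opow S i @` D).
Proof.
move=> DV _ _ k [d dD <-] [d' dD' <-] kn.
rewrite -opowD addnC opowD; apply/(disj_isoE (disj_iso_pow i SS')).
exact: DV.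
Qed.

Lemma free_set_disj n D z j k : free_set S n D -> dcompl (dcompl D) z ->
  (j < n.+1)%N -> (k < n.+1)%N -> j != k -> disj (opow T j z) (opow T k z).
Proof.
move=> DV zD jn kn jk.
have main p q : (p < q)%N -> (q < n.+1)%N -> disj (opow T p z) (opow T q z).
  move=> pq qn; apply: (dominated_disj (dominated_pow p SS' ST)); apply: disjC.
  apply: (dominated_disj (dominated_pow q SS' ST)); apply: disjC.
  rewrite /= -(subnKC (ltnW pq)) opowD; apply/(disj_isoE (disj_iso_pow p SS')).
  apply: (free_set_band SS' DV) => //; rewrite subn_gt0 pq/=.
  exact: leq_trans (leq_subr _ _) _.
by move: jk; rewrite neq_ltn => /orP[jk|kj]; [|apply: disjC]; exact: main.
Qed.

(** Where [S ^ n.+1] is local and no smaller power is, [T] acts on towers of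
    height [n.+1] with a local return map, and [1 + T + ... + T ^ n] reduces
    [1 - T] to [1 - T ^ n.+1]. *)
Lemma lower_periodic n : exists2 C : R, 0 <= C & forall x,
  antiperiodic S n x -> recurrent S n.+1 x -> rnorm x <= C * rnorm (x - T x).
Proof.
have [C C0 TC] := opow_near n.+1 Tb.
have [D DV Dcov] := free_cover SS' n 0.
exists ((n + n).+1%:R * (c^-1 * C)).
  by rewrite mulr_ge0// mulr_ge0// invr_ge0 ltW.
move=> x xH xF; rewrite -mulrA.
apply: (@proj_cover_bound _ _ _ (fun i => opow S i @` D)) => [z zx zD|i _].
  by apply: Dcov => //; exact: antiperiodic_le zx xH.
have DiV := @free_set_image n i D DV; set Di := opow S i @` D in DiV *.
set z := proj Di x.
have zF : recurrent S n.+1 z by apply: dcompl_le xF; exact: proj_le.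
have yF : recurrent S n.+1 (x - z) by apply: dcompl_le xF; exact: subproj_le.
pose G := dcompl Di `|` wandering S n.+1.
have GE y : dcompl G y -> dcompl (dcompl Di) y /\ recurrent S n.+1 y.
  by move=> yG; split => w Gw; apply: yG; [left|right].
have zG : dcompl G z by move=> w [|wW]; [exact: proj_in|exact: zF].
have tG : tower n.+1 G.
  move=> u v k /GE[uD uF] /GE[vD vF] uv; rewrite leq_eqVlt => /predU1P[->|].
    exact: (recurrent_local SS').
  by rewrite ltnS; exact: (free_set_tower DiV).
have dom := dominated_pow n.+1 SS' ST.
have TzE : z - opow T n.+1 z = proj Di (x - opow T n.+1 x).
  apply/esym/proj_uniq.
    apply: dcomplB; first exact: proj_in.
    apply: (dominated_dcompl dom) => g gD; apply: (recurrent_local SS') => //.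
    by apply: proj_in.
  have -> : x - opow T n.+1 x - (z - opow T n.+1 z) =
      (x - z) - opow T n.+1 (x - z) 
    by rewrite [opow _ _ (x - z)]linearB !opprB [LHS](AC (2*2) ((1*4)*(3*2))).
  apply: dcomplB; first exact: proj_out.
  apply: (dominated_dcompl dom) => g gD; apply: (recurrent_local SS') => //.
  exact: proj_out.
have cz : c * rnorm z <= rnorm (z - opow T n.+1 z).
  have := lower_opoly (fun=> 1) tG zG; rewrite opoly_telescope.
  rewrite [X in _ *: z + X](_ : _ = 0) ?addr0 ?scale1r; last first.
    by rewrite /opoly big1// => k _; rewrite subrr scale0r.
  apply: le_trans; apply: ler_wpM2l; first exact: ltW.
  apply: (@rnorm_opow_le_opoly _ _ (fun=> 1) n.+1 0 T z) => // j k jn kn jk.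
  by apply: (free_set_disj DiV); [exact: proj_in|..].
rewrite -mulrA ler_pdivlMl// (le_trans cz)// TzE; apply: le_trans (TC x).
by apply: rnorm_mono; exact: proj_le.
Qed.

(** Along a tower of height [2 m + 1] the images of an element of the base are
    added with the weight [peak], which changes by the factor [(1 + h) ^ 2] from
    one level to the next. So [1 - T] multiplies the norm of the sum by at most
    [c / 2], except for the contributions of the two ends of the tower. These
    are exponentially small in [m], while the number of towers needed to cover
    is [4 m + 3]. *)
Lemma lower_antiperiodic : exists n, exists2 C : R, 0 <= C & forall x,
  antiperiodic S n x -> rnorm x <= C * rnorm (x - T x).
Proof.
(* small enough for [(1 + h) ^ 2 <= 1 + c / 2] *)
pose h : R := Num.min (c / 8) 1.
have h0 : 0 < h by rewrite lt_min ltr01 andbT divr_gt0.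
have h1 : h <= 1 by rewrite ge_min lexx orbT.
have hc : h <= c / 8 by rewrite ge_min lexx.
have [m mle] := @linear_geometric_small R h (4 / c) 2^-1 h0
  (ltac:(by rewrite divr_ge0// ltW)) (ltac:(by rewrite invr_gt0)).
pose q := ((1 + h) ^+ 2)^-1; rewrite -/q in mle.
have q1 : q * (1 + h) ^+ 2 = 1 by rewrite mulVf// gt_eqF// exprn_gt0// addr_gt0.
have q0 : 0 < q by rewrite invr_gt0 exprn_gt0// addr_gt0.
have hq : (1 + h) ^+ 2 <= 1 + c / 2.
  have : h ^+ 2 <= h by rewrite expr2 ler_piMr// ltW.
  by rewrite sqrrD expr1n mul1r; lra.
have qle1 : q <= 1.
  by rewrite invf_le1 ?exprn_gt0 ?addr_gt0// exprn_ege1// lerDl ltW.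
have [C1 C10 TC1] := opow_near m Tb.
pose N := (m + m).+1.
have [C2 C20 TC2] := opow_near N Tb.
have [D DV Dcov] := free_cover SS' N m.
pose a := peak q m.
have am : a m = 1 by rewrite /a/peak subnn expr0.
have qc : 1 - q <= c / 2 * q.
  have : q * ((1 + h) ^+ 2 - 1) <= q * (c / 2).
    by rewrite ler_wpM2l ?(ltW q0)//; lra.
  by rewrite mulrBr q1 mulr1 [q * _]mulrC.
have ba k : `|a k - a k.-1| <= c / 2 * `|a k| by apply: peak_step; rewrite ?q0.
pose M x := 2 / c * (2 * q ^+ m * rnorm x + C2 * rnorm (x - T x)) +
  C1 * rnorm (x - T x).
have qm0 : 0 <= q ^+ m by rewrite exprn_ge0// ltW.
have qm1 : q ^+ m <= 1 by rewrite exprn_ile1// ltW.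
have key x i : (i < (N + N).+1)%N -> antiperiodic S N x ->
    rnorm (proj (opow S (m + i) @` D) x) <= M x.
  move=> iN xH.
  have DiV := @free_set_image N i D DV; set Di := opow S i @` D in DiV *.
  set z := proj Di x.
  have zD : dcompl (dcompl Di) z by exact: proj_in.
  have tG : tower N (dcompl Di) := @free_set_tower N Di DiV.
  have dis j k : (j < N)%N -> (k < N)%N -> j != k ->
      disj (opow T j z) (opow T k z).
    by move=> jN kN jk; apply: (free_set_disj DiV) => //; exact: ltnW.
  have Tz k : opow T k z = proj (opow S k @` Di) (opow T k x).
    by rewrite (proj_image Di x (disj_iso_pow k SS') (dominated_pow k SS' ST)).
  have Tzx k : rnorm (opow T k z) <= rnorm (opow T k x).
    by rewrite Tz; apply: rnorm_mono; exact: proj_le.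
  set w := opoly a N T z.
  (* the middle level of the tower, where the weight is one *)
  have wz : rnorm (opow T m z) <= rnorm w.
    by apply: rnorm_opow_le_opoly => //; rewrite ltnS leq_addr.
  (* the weight varies slowly inside the tower *)
  have bw : rnorm (opoly (fun k => a k - a k.-1) N T z) <= c / 2 * rnorm w.
    have c20 : 0 <= c / 2 by rewrite divr_ge0// ltW.
    rewrite /rnorm -[c / 2](ger0_norm c20) -normrZ.
    apply: vle_norm_ge0; first exact: modulus_ge0.
    apply: modulus_opoly_le => // j k /andP[jk kN].
    by apply: dis; rewrite ?(ltn_trans jk)// ltn_eqF.
  have Nx : rnorm (opow T N x) <= rnorm x + C2 * rnorm (x - T x).
    apply: le_trans (rnorm_le_sub _ x) _; rewrite lerD2l -rnormN opprB.
    exact: TC2.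
  have zx : rnorm z <= rnorm x := Tzx 0%N.
  have := lower_opoly a tG zD; rewrite -/w opoly_telescope -/N.
  have -> : a 0%N = q ^+ m by rewrite /a/peak sub0n subn0.
  have -> : a (m + m)%N = q ^+ m.
    by rewrite /a/peak addnK subnDA subnn sub0n addn0.
  move=> /le_trans/(_ (rnormB _ _)); set u1 := rnorm (_ + _).
  have u1le : u1 <= q ^+ m * rnorm z + c / 2 * rnorm w.
    apply: le_trans (rnormD _ _) _; rewrite lerD// rnormZ norm_real ger0_norm//.
  rewrite rnormZ norm_real (ger0_norm qm0) => cw.
  have z1 : q ^+ m * rnorm z <= q ^+ m * rnorm x by rewrite ler_wpM2l.
  have z2 : q ^+ m * rnorm (opow T N z) <=
      q ^+ m * rnorm x + C2 * rnorm (x - T x).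
    apply: (@le_trans _ _ (q ^+ m * (rnorm x + C2 * rnorm (x - T x)))).
      by rewrite ler_wpM2l// (le_trans (Tzx N)).
    by rewrite mulrDr lerD2l ler_piMl// mulr_ge0// rnorm_ge0.
  have wle : rnorm w <= 2 / c * (2 * q ^+ m * rnorm x + C2 * rnorm (x - T x)).
    by rewrite mulrAC ler_pdivlMr// mulrC; lra.
  rewrite /M; have EE : opow S (m + i) @` D = opow S m @` Di.
    rewrite /Di image_comp; congr image; apply/funext => d.
    by rewrite /= opowD.
  rewrite EE.
  apply: le_trans (rnorm_le_sub _ (proj (opow S m @` Di) (opow T m x))) _.
  apply: lerD; first by rewrite -Tz (le_trans wz).
  rewrite -linearB; apply: le_trans (TC1 x); apply: rnorm_mono.
  exact: proj_le.
exists N; exists (2 * ((N + N).+1%:R * (2 / c * C2 + C1))).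
  by rewrite !mulr_ge0// addr_ge0// mulr_ge0// divr_ge0// ltW.
move=> x xH; have : rnorm x <= (N + N).+1%:R * M x.
  apply: (@proj_cover_bound _ _ _ (fun i => opow S (m + i) @` D)).
    move=> z zx zD.
    by apply: Dcov => //; exact: antiperiodic_le zx xH.
  by move=> i iN; exact: key.
have -> : (N + N).+1 = (4 * m + 3)%N.
  by rewrite addn3 -[4%N]/(2 * 2)%N -mulnA !mul2n -!addnn /N addSn addnS.
have : (4 * m + 3)%:R * (4 / c) * q ^+ m * rnorm x <= 2^-1 * rnorm x.
  by rewrite ler_wpM2r// rnorm_ge0.
rewrite /M; set n := (_ + _)%:R; set d := rnorm (x - T x).
have -> : n * (2 / c * (2 * q ^+ m * rnorm x + C2 * d) + C1 * d) =
  n * (4 / c) * q ^+ m * rnorm x + n * (2 / c * C2 + C1) * d.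
  by field; rewrite gt_eqF.
by rewrite -!mulrA; set p := n * _; set p' := n * _; lra.
Qed.


(** Splitting off the bands where [S], [S ^ 2], ... are local, one at a time,
    reduces to the two preceding cases; [T] respects each splitting. *)
Lemma lower_extends :
  exists2 C : R, 0 <= C & forall x, rnorm x <= C * rnorm (x - T x).
Proof.
have [n low_n] := lower_antiperiodic.
suff low0 : exists2 C : R, 0 <= C & forall x,
    antiperiodic S 0 x -> rnorm x <= C * rnorm (x - T x).
  have [C C0 xC] := low0; exists C => // x; apply: xC => k.
  by case: k.
elim: n low_n => // n IH [C C0 xC]; apply: IH.
have [L L0 xL] := lower_periodic n.
exists (L + C) => [|x xH]; first exact: addr_ge0.
pose W := wandering S n.+1; set q := proj W x; pose p := x - q.
have qF : dcompl (recurrent S n.+1) q := proj_in W x.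
have pF : recurrent S n.+1 p := proj_out W x.
have pH : antiperiodic S n p by apply: antiperiodic_le xH; exact: subproj_le.
have qH : antiperiodic S n.+1 q.
  move=> k /andP[k0]; rewrite leq_eqVlt => /predU1P[-> //|kn].
  by apply: (dcompl_le (proj_le W x)); apply: xH; rewrite k0.
have pTF : recurrent S n.+1 (p - T p).
  apply: dcomplB => //; apply: (dominated_dcompl ST); exact: (recurrent_S SS').
have qTF : dcompl (recurrent S n.+1) (q - T q).
  apply: dcomplB => //; apply: (dominated_dcompl ST).
  apply: (dcompl_invariant SS') => //.
  by move=> y; exact: (recurrent_S' SS').
have pq : disj (p - T p) (q - T q) by apply: disjC; exact: qTF.
have xE : x - T x = (p - T p) + (q - T q).
  by rewrite addrACA -opprD -linearD subrK.
have xpq : rnorm x <= rnorm p + rnorm q by rewrite -{1}(subrK q x) rnormD.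
apply: le_trans xpq _; rewrite mulrDl; apply: lerD.
  by apply: le_trans (xL p pH pF) _; rewrite ler_wpM2l// xE rnorm_leDl.
by apply: le_trans (xC q qH) _; rewrite ler_wpM2l// xE rnorm_leDr.
Qed.

End LowerBound.

(** * The approximate point spectrum *)

Section Spectra.
(** An operator that is not bounded below on [W] has no bounded inverse, so
    that it is enough to negate the lower bound. *)
Lemma spectrum_apE (K : numFieldType) (V : normedModType K) (T : V -> V)
    (W : set V) (l : K) : (forall x, W x -> W (l *: x - T x)) ->
  spectrum_ap T W l <->
  ~ exists2 c : K, 0 < c & forall x, W x -> c * `|x| <= `|l *: x - T x|.
Proof.
move=> WT; split => [[sp nr] low|nlow]; first by apply: nr; split.
split; last by case.
move=> [B [[_ _ [M BM]] BK _]]; apply: nlow.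
have M0 : 0 < `|M| + 1 by rewrite ltr_wpDl.
exists (`|M| + 1)^-1 => [|x Wx]; first by rewrite invr_gt0.
have := BM _ (WT x Wx); rewrite BK ?inE// => xM.
rewrite ler_pdivrMl//; apply: (le_trans xM).
have -> : M * `|l *: x - T x| = `|M| * `|l *: x - T x|.
  by rewrite -(ger0_norm (le_trans (normr_ge0 x) xM)) normrM normr_id.
by rewrite ler_wpM2r// lerDl.
Qed.

End Spectra.

Lemma rnorm_bounded_of {R : realType} {E : dedekindBanachLatticeType R}
    (f : complexification E -> complexification E) :
  bounded_operator_on setT f -> rnorm_bounded f.
Proof.
move=> [_ _ [M fM]]; exists (complex.Re `|M|) => [|x]; first exact: Renorm_ge0.
have := fM x I; rewrite !normE => xM.
have -> : rnorm (f x) = complex.Re (rnorm (f x))%:C%C by [].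
rewrite -lecR; apply: (le_trans xM).
have M0 : 0 <= M * (rnorm x)%:C%C.
  by apply: le_trans xM; rewrite lecR rnorm_ge0.
rewrite -(ger0_norm M0) normrM [`|M|]normC_real.
by rewrite -normE normr_id normE -rmorphM.
Qed.

Theorem theorem0p3 (R : realType) (E : dedekindBanachLatticeType R)
    (S A : {linear complexification E -> complexification E})
    (Y : set (complexification E)) :
  d_isomorphism S ->
  in_center A ->
  aim_subspace Y ->
  (A \o S) @` Y `<=` Y ->
  spectrum_ap (A \o S) setT = spectrum_ap (A \o S) Y.
Proof.
move=> [Sbd [B [Bbd SB BS]] Sdisj] [k k0 Ak] Yaim YT.
have Blin : linear B by case: Bbd => _ Bl _ u x y; exact: Bl.
pose S' : {linear complexification E -> complexification E} :=
  HB.pack B (GRing.isLinear.Build R[i]%C _ _ *:%R B Blin).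
have SS' : disj_iso S S'.
  apply: disj_isoI; [exact: rnorm_bounded_of|exact: rnorm_bounded_of| | |].
  - by move=> x; apply: SB; rewrite inE.
  - by move=> x; apply: BS; rewrite inE.
  - by move=> x y _ _; exact: Sdisj.
have AS : dominated S (A \o S) by exists k => // x; exact: Ak.
have [[Y0 YP] _ _] := Yaim.
have Yinv l y : Y y -> Y (l *: y - (A \o S) y).
  move=> Yy; have YTy : Y ((A \o S) y) by apply: YT; exists y.
  have Yl : Y (l *: y) by have := YP l y 0 _ Y0; rewrite !inE addr0; apply.
  by have := YP (-1) ((A \o S) y) (l *: y); rewrite !inE scaleN1r addrC; apply.
suff low l : (exists2 c : R[i]%C, 0 < c & forall x, Y x ->
      c * `|x| <= `|l *: x - (A \o S) x|) ->
    exists2 c : R[i]%C, 0 < c & forall x, setT x ->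
      c * `|x| <= `|l *: x - (A \o S) x|.
  apply/seteqP; split => l.
    move=> /(@spectrum_apE _ _ _ _ l (fun _ _ => I)) nl.
    by apply/(@spectrum_apE _ _ _ _ l (Yinv l)) => /low.
  move=> /(@spectrum_apE _ _ _ _ l (Yinv l)) nl.
  apply/(@spectrum_apE _ _ _ _ l (fun _ _ => I)) => -[c c0 cX].
  by apply: nl; exists c => // x _; exact: cX.
move=> [c c0 cY].
have cE : c = (complex.Re c)%:C%C by rewrite RRe_real// gtr0_real.
set r := complex.Re c in cE; have r0 : 0 < r by rewrite -ltcR -cE.
have {cY} rY y : Y y -> r * rnorm y <= rnorm (l *: y - (A \o S) y).
  by move=> /cY; rewrite cE !normE -rmorphM lecR.
suff [C C0 CX] : exists2 C : R, 0 <= C &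
    forall x, rnorm x <= C * rnorm (l *: x - (A \o S) x).
  have C1 : 0 < C + 1 by rewrite ltr_wpDl.
  exists ((C + 1)^-1)%:C%C; first by rewrite ltcR invr_gt0.
  move=> x _; rewrite !normE -rmorphM lecR ler_pdivrMl//.
  by apply: le_trans (CX x) _; rewrite ler_wpM2r ?rnorm_ge0// lerDl.
have Sb := disj_iso_bounded SS'; have ASb := dominated_bounded Sb AS.
have [l0|l0] := eqVneq l 0.
  exists r^-1 => [|x]; first by rewrite invr_ge0 ltW.
  rewrite l0 scale0r sub0r rnormN ler_pdivlMl//.
  apply: (@aim_lower _ _ idfun (A \o S) Y set0 r Yaim (ltW r0)) => //.
  - by exists 1 => // y; rewrite mul1r.
  - by move=> y z _ _ yz; apply: (dominated_disj AS); apply: disjC;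
      apply: (dominated_disj AS); apply: disjC; apply/(disj_isoE SS').
  - by move=> y /rY; rewrite l0 scale0r sub0r rnormN.
pose T : {linear complexification E -> complexification E} :=
  l^-1 \*: (A \o S).
have TE x : x - T x = l^-1 *: (l *: x - (A \o S) x).
  by rewrite scalerBr scalerA mulVf// scale1r.
have ST : dominated S T.
  exists (complex.Re `|l^-1| * k); first by rewrite mulr_ge0 ?Renorm_ge0.
  by move=> x; rewrite /= modulusZ -scalerA vle_scale ?Renorm_ge0.
have YTT y : Y y -> Y (T y).
  move=> Yy; have YTy : Y ((A \o S) y) by apply: YT; exists y.
  by have := YP l^-1 ((A \o S) y) 0 _ Y0; rewrite !inE addr0; apply.
have lV0 : 0 < complex.Re `|l^-1|.
  by rewrite -ltcR -normC_real normr_gt0 invr_eq0.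
have [|C C0 CX] := lower_extends SS' ST Yaim YTT (mulr_gt0 lV0 r0).
  move=> y /rY yr; rewrite TE rnormZ -mulrA.
  by apply: ler_wpM2l yr; exact: Renorm_ge0.
exists (C * complex.Re `|l^-1|); first by rewrite mulr_ge0 ?Renorm_ge0.
by move=> x; rewrite -mulrA -rnormZ -TE.
Qed.
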